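(* Let $k\ge 1$ and $l,m,n\ge 0$ be integers. Let $E_{k,k}(l,m,n)$ denote the number of lattice paths satisfying the special $(k,k)$-conditions with major index $n$, in which the sum of the relative heights of all peaks is $m$ and the full lower even peak parity index is $l$. Let $B_{k,k}(l,m,n)$ denote the number of partitions enumerated by $B_{k,k}(m,n)$ whose full lower even cluster parity index is $l$. Then \[E_{k,k}(l,m,n)=B_{k,k}(l,m,n).\]
   Context: Partitions: a partition of $n$ is a finite non-increasing sequence of positive integers $\lambda_1\ge\cdots\ge\lambda_s>0$ with sum $n$. $B_{k,k}(m,n)$ denotes the number of partitions $\lambda_1\ge\cdots\ge\lambda_m$ of $n$ with exactly $m$ parts such that $\lambda_j-\lambda_{j+k-1}\ge 2$ for $1\le j\le m-k+1$ and at most $k-1$ of the parts are equal to $1$. Gordon marking: the Gordon marking of a partition $\lambda$ is an assignment of positive integers (marks) to the parts of $\lambda$ such that any two equal parts, as well as any two nearly equal parts $j$ and $j+1$, are assigned different marks, and the marks are as small as possible assuming that the marks are assigned to the parts in increasing order. An $r$-cluster in $\lambda$ is a sub-partition $\lambda_{i_1}\le\cdots\le\lambda_{i_r}$ such that $\lambda_{i_j}$ is $j$-marked for $j=1,\dots,r$, $\lambda_{i_{j+1}}-\lambda_{i_j}\le 1$ for $j=1,\dots,r-1$, and there are no $(r+1)$-marked parts equal to $\lambda_{i_r}$ or $\lambda_{i_r}+1$. Every partition with its Gordon marking has a unique decomposition into non-overlapping clusters ($r$-clusters for various $r$); the clusters below are those of this decomposition. The parity of an $r$-cluster is the opposite of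 the parity of the number of even parts in that $r$-cluster. The lower even $r$-cluster parity index of $\lambda$ is the number of times that the $r$-cluster parity changes from the $r$-cluster with the smallest $r$-marked part to the one with the largest $r$-marked part, beginning with an even $r$-cluster parity. The full lower even cluster parity index of a partition enumerated by $B_{k,k}(m,n)$ is the sum of its lower even $r$-cluster parity indices over $r=1,\dots,k-1$. Lattice paths: a lattice path is a path in the first quadrant ($x,y\ge 0$, integer vertices) that starts on the $y$-axis (at $x=0$), ends on the $x$-axis, and uses unit steps of three kinds: North-East $(x,y)\to(x+1,y+1)$; South-East $(x,y)\to(x+1,y-1)$; East $(x,0)\to(x+1,0)$, which is allowed only at height $0$. A path is either empty or ends with a South-East step. The height of a vertex $(x,y)$ is $y$ and its weight is $x$. A peak is a vertex preceded by a North-East step and followed by a South-East step. The major index of a path is the sum of the weights of its peaks. A path satisfies the special $(k,k)$-conditions if it starts at height $0$ and all its vertices have height less than $k$. The relative height of a peak $(x,y)$ is the largest integer $h$ for which there are two vertices on the path, $(x',y-h)$ and $(x'',y-h)$, with $x'<x<x''$, such that between these two vertices there are no peaks of height $>y$ and every peak of height $y$ has abscissa $\ge x$. The parity of a peak of weight $x$ and relative height $r$ is the opposite of the parity of $x-r$ (so the peak is odd if $x-r$ is even, and even if $x-r$ is odd). The lower even $r$-peak parity index of a lattice path is the number of times that the parity of the peaks with relative height $r$ changes from the leftmost to the rightmost, beginning with a peak of even parity and relative height $r$. The full lower even peak parity index of a path satisfying the special $(k,k)$-conditions is the sum of its lower even $r$-peak parity indices over $r=1,\dots,k-1$. Meaning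 of ''number of changes beginning with an even parity'' (for both indices): given a finite sequence of parities, it is the maximum length of an alternating subsequence even, odd, even, ... whose first term is even; equivalently, the number of parity changes between consecutive terms after an extra odd term is prepended to the sequence. (For example: (odd) gives 0, (even) gives 1, (odd, even) gives 1, (even, even) gives 1, (even, odd) gives 2.) *)

(* Defs.v *)
From HB Require Import structures.
From mathcomp Require Import all_boot.

Set Implicit Arguments.
Unset Strict Implicit.
Unset Printing Implicit Defensive.

(* Parities are booleans, [true] standing for odd. Prepending an odd term to a
   sequence of parities, this counts the changes between consecutive terms. *)
Definition parity_changes_from_even (s : seq bool) : nat :=
  count id (pairmap (fun b b' => b != b') true s).

Definition is_partition_of (n : nat) (la : seq nat) : bool :=
  [&& sorted geq la, all (fun p => 0 < p) la & sumn la == n].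

(* Indices are shifted: the j-th entry (from 0) is $\lambda_{j+1}$. *)
Definition Bkk_condition (k : nat) (la : seq nat) : bool :=
  all (fun j => nth 0 la (j + k.-1) + 2 <= nth 0 la j)
      (iota 0 ((size la).+1 - k))
  && (count_mem 1 la <= k.-1).

(* By the pigeonhole principle one of 1, ..., (size u).+1 is not in u. *)
Definition least_unused (u : seq nat) : nat :=
  (find (fun r => r.+1 \notin u) (iota 0 (size u).+1)).+1.

(* The parts of a partition are listed in non-increasing order, hence the tail
   of the list is marked first. *)
Fixpoint gordon_marking (la : seq nat) : seq nat :=
  if la is p :: la' then
    let mk := gordon_marking la' in
    least_unused [seq q.2 | q <- zip la' mk & (q.1 == p) || (q.1.+1 == p)] :: mk
  else [::].

Definition part (la : seq nat) (i : 'I_(size la)) : nat := nth 0 la i.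
Arguments part : clear implicits.

Definition mark (la : seq nat) (i : 'I_(size la)) : nat :=
  nth 0 (gordon_marking la) i.
Arguments mark : clear implicits.

(* A sub-partition is given by the set C of the positions of its parts. *)
Definition is_cluster (la : seq nat) (r : nat) (C : {set 'I_(size la)}) : bool :=
  (0 < r) &&
  [exists c : r.-tuple 'I_(size la),
    let top := last 0 [seq part la i | i <- c] in
    [&& C == [set:: c],
        [seq mark la i | i <- c] == iota 1 r,
        sorted (fun p q => p <= q <= p.+1) [seq part la i | i <- c]
      & [forall i, (mark la i == r.+1) ==>
                   (part la i \notin [:: top; top.+1])]]].
Arguments is_cluster : clear implicits.

(* The positions in an r-cluster have distinct marks, so r = #|C|. *)
Definition is_cluster_decomposition (la : seq nat)
    (D : {set {set 'I_(size la)}}) : bool :=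
  partition D [set: 'I_(size la)] && [forall C in D, is_cluster la #|C| C].
Arguments is_cluster_decomposition : clear implicits.

(* The decomposition of a partition exists and is unique; [set0] is a dummy. *)
Definition cluster_decomposition (la : seq nat) : {set {set 'I_(size la)}} :=
  odflt set0 [pick D | is_cluster_decomposition la D].

Definition cluster_parity (la : seq nat) (C : {set 'I_(size la)}) : bool :=
  ~~ odd #|[set i in C | ~~ odd (part la i)]|.
Arguments cluster_parity : clear implicits.

(* Each r-cluster is reached through its r-marked part; positions are visited
   backwards, that is by increasing parts (r-marked parts being distinct). *)
Definition cluster_parities (la : seq nat) (r : nat) : seq bool :=
  let D := cluster_decomposition la in
  [seq cluster_parity la (pblock D i)
     | i <- rev (enum 'I_(size la)) & (mark la i == r) && (#|pblock D i| == r)].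

Definition full_cluster_parity_index (la : seq nat) (k : nat) : nat :=
  \sum_(1 <= r < k) parity_changes_from_even (cluster_parities la r).

(* The parts of a partition of n are at most n. *)
Definition Bkk (k l m n : nat) : nat :=
  #|[set t : m.-tuple 'I_n.+1 |
      let la := [seq val p | p <- t] in
      [&& is_partition_of n la, Bkk_condition k la
        & full_cluster_parity_index la k == l]]|.

Inductive step : predArgType := NorthEast | SouthEast | East.

Definition option_of_step (st : step) : option bool :=
  match st with
  | NorthEast => Some true | SouthEast => Some false | East => None
  end.

Definition step_of_option (o : option bool) : step :=
  match o with
  | Some true => NorthEast | Some false => SouthEast | None => East
  end.

Lemma option_of_stepK : cancel option_of_step step_of_option.
Proof. by case. Qed.

HB.instance Definition _ := Finite.copy step (can_type option_of_stepK).

Definition next_height (h : nat) (st : step) : nat :=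
  match st with NorthEast => h.+1 | SouthEast => h.-1 | East => h end.

Definition legal_step (h : nat) (st : step) : bool :=
  match st with NorthEast => true | SouthEast => 0 < h | East => h == 0 end.

Fixpoint legal_from (h : nat) (p : seq step) : bool :=
  if p is st :: p' then legal_step h st && legal_from (next_height h st) p'
  else true.

(* A path from the origin is given by its steps. As every step increases the
   abscissa by 1, its vertices are the (x, height p x) with x <= size p. *)
Definition height (p : seq step) (x : nat) : nat :=
  foldl next_height 0 (take x p).

Definition is_lattice_path (p : seq step) : bool :=
  [&& legal_from 0 p, height p (size p) == 0
    & (p == [::]) || (last East p == SouthEast)].

Definition special_kk (k : nat) (p : seq step) : bool :=
  all (fun x => height p x < k) (iota 0 (size p).+1).

Definition is_peak (p : seq step) (x : nat) : bool :=
  [&& 0 < x, nth East p x.-1 == NorthEast & nth East p x == SouthEast].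

Definition peaks (p : seq step) : seq nat :=
  [seq x <- iota 0 (size p) | is_peak p x].

Definition major_index (p : seq step) : nat := \sum_(x <- peaks p) x.

Definition relative_height (p : seq step) (x : nat) : nat :=
  let y := height p x in
  \max_(h < y.+1 | [exists x' : 'I_(size p).+1, exists x'' : 'I_(size p).+1,
      [&& x' < x < x'', height p x' == y - h, height p x'' == y - h
        & all (fun z => (height p z <= y) && ((height p z == y) ==> (x <= z)))
              [seq z <- peaks p | x' < z < x'']]]) h.

(* x + r has the parity of x - r. *)
Definition peak_parity (p : seq step) (x : nat) : bool :=
  ~~ odd (x + relative_height p x).

Definition peak_parities (p : seq step) (r : nat) : seq bool :=
  [seq peak_parity p x | x <- peaks p & relative_height p x == r].

Definition full_peak_parity_index (p : seq step) (k : nat) : nat :=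
  \sum_(1 <= r < k) parity_changes_from_even (peak_parities p r).

Lemma foldl_next_height_le (p : seq step) (h : nat) :
  foldl next_height h p <= h + size p.
Proof.
elim: p h => [|st p IH] h /=; first by rewrite addn0.
apply: leq_trans (IH _) _; rewrite addnS -addSn leq_add2r.
by case: st => //=; apply: leq_trans (leq_pred h) _.
Qed.

Lemma legal_from_cat (p q : seq step) (h : nat) :
  legal_from h (p ++ q) =
  legal_from h p && legal_from (foldl next_height h p) q.
Proof. by elim: p h => //= st p IH h; rewrite IH andbA. Qed.

Lemma legal_from_SouthEast (j h : nat) :
  legal_from h (nseq j SouthEast) = (j <= h).
Proof. by elim: j h => [|j IH] [|h] //=; rewrite IH. Qed.

Lemma split_SouthEast (p : seq step) :
  exists q j, p = q ++ nseq j SouthEast /\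
              (q = [::] \/ last East q != SouthEast).
Proof.
elim/last_ind: p => [|p st [q [j [-> Hq]]]]; first by exists [::], 0; split; [|left].
case: st; [exists (rcons (q ++ nseq j SouthEast) NorthEast), 0
  | exists q, j.+1 | exists (rcons (q ++ nseq j SouthEast) East), 0].
- by rewrite cats0 last_rcons; split; [|right].
- by rewrite rcons_cat -cats1 -(nseqD j 1) addn1.
- by rewrite cats0 last_rcons; split; [|right].
Qed.

(* A path of major index n has at most 2n steps, whence the finite type used in
   [Ekk]. *)
Lemma size_lattice_path (p : seq step) :
  is_lattice_path p -> size p <= (major_index p).*2.
Proof.
case/and3P=> + _; case: p => [|st p0] //; set p := st :: p0 => + /= /eqP last_p.
have [q [[|j] [def_p Hq]]] := split_SouthEast p.
  by move: Hq; rewrite cats0 in def_p; rewrite -def_p /= last_p; case.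
rewrite {1}def_p legal_from_cat legal_from_SouthEast => /andP[legal_q].
case/lastP: q => [|q e] // in def_p Hq legal_q *.
have {Hq} : last East (rcons q e) != SouthEast.
  by case: Hq => // eq0; move: (size_rcons q e); rewrite eq0.
move=> + le_j; have := leq_trans le_j (foldl_next_height_le (rcons q e) 0).
move: legal_q le_j; rewrite last_rcons size_rcons add0n.
rewrite -cats1 legal_from_cat foldl_cat /= andbT.
case: e def_p => // def_p; last by case/andP=> _ /= /eqP ->.
move=> _ _ le_j_q _.
have peak_q : is_peak p (size q).+1.
  rewrite /is_peak def_p /= !nth_cat size_rcons leqnn ltnn subnn /=.
  by rewrite nth_rcons ltnn eqxx.
have q_peaks : (size q).+1 \in peaks p.
  rewrite mem_filter peak_q mem_iota add0n def_p size_cat size_rcons size_nseq.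
  by rewrite addnS ltnS leq_addr.
have -> : (size p0).+1 = (size q).+1 + j.+1.
  by rewrite -[LHS]/(size p) def_p size_cat size_rcons size_nseq.
apply: (@leq_trans (size q).+1.*2); first by rewrite -addnn leq_add2l.
by rewrite leq_double /major_index (big_rem _ q_peaks) /= leq_addr.
Qed.

Definition Ekk (k l m n : nat) : nat :=
  #|[set p : (n.*2).-bseq step |
      [&& is_lattice_path p, special_kk k p, major_index p == n,
          \sum_(x <- peaks p) relative_height p x == m
        & full_peak_parity_index p k == l]]|.

(* Main.v *)
Require Import Defs.
From mathcomp Require Import all_boot zify.
From Stdlib Require Import FunctionalExtensionality.

Set Implicit Arguments.
Unset Strict Implicit.
Unset Printing Implicit Defensive.

(** Burge's correspondence, seen as a dynamical system. Describe a partition by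
    its frequencies f_0, f_1, ..., where f_i is the number of parts i. Starting
    from the largest part, pair off the sites: i - 1 and i, where i is the
    largest uncovered site with f_i > 0. One step moves a part from i to i - 1
    in each pair, parts that become negative being lost. Along the iterates,
    f_0 goes up, goes down or stays at 0, hence describes a lattice path. The
    step is invertible; as each pair corresponds to a peak still to come, the
    major index is the sum of the parts, and the conditions f_i + f_(i+1) < k
    amount to the height being less than k.

    As for the parities, let the step act on all integer sites. It moves the
    least mark of i, which is the least mark missing at i - 1, so that it sends
    Gordon markings to Gordon markings, and up to exchanges of clusters of equal
    parity each cluster loses 1. Hence the clusters formed by the parts that
    are at most 0 can be followed on the path: with U the set of marks of
    site 0, a North-East step adds the least mark x not in U, which extends the
    last (x-1)-cluster, and any other step removes the least mark of U. This
    procedure also computes the relative heights of the peaks, by induction on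
    the excursions of the path: raising an excursion adds 1 to the relative
    height of its leftmost highest peak only. *)

(** * The dynamics on frequencies *)

(** The parity indices only see, for each r, the list of the parities of the r-clusters by
    increasing parts. This is why the exchanges are harmless: no cluster has to be identified
    through time, and functions from r to such lists are carried instead. As the pairing starts from
    the largest part and the marking from the smallest, statements about a lower block of sites take
    as an extra argument the mark about to enter it from above.

    Site 0 acts as a window. Before the first step no part is at most 0, after the last one all are,
    and each step flips every parity. So the scan of a path [p], run from the empty state, ends with
    all the clusters of the partition, flipped [size p] times. The same scan is evaluated a second
    time from the path alone, where it returns the parities of the peaks sorted by relative height;
    comparing the two values settles the parities. The same induction on excursions shows that the
    sum of the relative heights is the number of South-East steps, each of which is the loss of a
    part, hence the number of parts. *)

(* Sites are paired off from the right: the largest site not yet covered that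
   holds a part is the top of a pair, together with the site below it. [is_top]
   tells whether the first site of the list is a top. *)
Fixpoint is_top (f : seq nat) : bool :=
  if f is x :: f' then ~~ is_top f' && (0 < x) else false.

(** A site below a top gains a part. Any other site is either a top, which loses one, or empty; the
    predecessor covers both cases. *)
Fixpoint shift_tops (f : seq nat) : seq nat :=
  if f is x :: f' then (if is_top f' then x.+1 else x.-1) :: shift_tops f'
  else [::].

Definition burge_step (f : seq nat) : step :=
  if is_top (behead f) then NorthEast
  else if 0 < head 0 f then SouthEast else East.

(* [p] records the evolution of the frequency of the first site, until no part
   is left. *)
Fixpoint burge_path (f : seq nat) (p : seq step) : bool :=
  if p is s :: p' then
    [&& 0 < sumn f, s == burge_step f & burge_path (shift_tops f) p']
  else sumn f == 0.

Lemma size_shift_tops f : size (shift_tops f) = size f.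
Proof. by elim: f => //= x f ->. Qed.

Lemma is_top_sumn f : is_top f -> 0 < sumn f.
Proof. by case: f => //= x f /andP[_]; lia. Qed.

Lemma sumn_shift_tops f : sumn (shift_tops f) + is_top f = sumn f.
Proof. by elim: f => //= x f; case: is_top => /=; case: x => [|x] /=; lia. Qed.

Lemma next_height_shift_tops f :
  next_height (head 0 f) (burge_step f) = head 0 (shift_tops f).
Proof. by case: f => //= x f; rewrite /burge_step /=; case: is_top; case: x. Qed.

Lemma burge_path_legal f p : burge_path f p ->
  legal_from (head 0 f) p && (foldl next_height (head 0 f) p == 0).
Proof.
elim: p f => [|s p IH] f /=; first by case: f => //= x f; rewrite addn_eq0 => /andP[].
case/and3P=> _ /eqP -> /IH; rewrite next_height_shift_tops -andbA => ->.
by rewrite andbT /burge_step; case: is_top => //=; case: head.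
Qed.

Lemma burge_path_last f p : burge_path f p -> (p == [::]) || (last East p == SouthEast).
Proof.
elim: p f => [|s p IH] f //= /and3P[f_gt0 /eqP -> pP].
case: p pP {IH}(IH _ pP) => [|//] /= /eqP f0 _.
have := sumn_shift_tops f; rewrite f0 add0n /burge_step.
by case: f f_gt0 {f0} => //= x f; case: is_top => /=; case: x => [|x] //=; lia.
Qed.

Lemma burge_path_uniq f p q : burge_path f p -> burge_path f q -> p = q.
Proof.
elim: p f q => [|s p IH] f [|s' q] //=.
- by move=> /eqP f0 /and3P[]; rewrite f0.
- by case/and3P=> f_gt0 _ _ /eqP f0; rewrite f0 in f_gt0.
by case/and3P=> _ /eqP -> pP /and3P[_ /eqP -> qP]; rewrite (IH _ q pP qP).
Qed.

(** If the second sites differed in being a top, a successor would equal a predecessor, so one of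
    the first sites would be a top and the other not. The remaining ambiguity, 0 against 1 before
    taking a predecessor, is also settled by [is_top]. *)
Lemma shift_tops_inj f g : size f = size g -> is_top f = is_top g ->
  shift_tops f = shift_tops g -> f = g.
Proof.
elim: f g => [|x f IH] [|y g] //= [sz] + [+ sh].
have [eq_top|] := boolP (is_top f == is_top g).
  by rewrite (IH g) ?(eqP eq_top) //; case: is_top => /=; case: x; case: y => //= n m;
     try by move=> _ [->].
by case: (is_top f); case: (is_top g) => //= _; case: x; case: y.
Qed.

(** The path is undone from the empty configuration: each recorded step tells whether site 1 is a
    top, and separates 0 from 1 at site 0. *)
Lemma burge_path_inj f g p : size f = size g ->
  burge_path f p -> burge_path g p -> f = g.
Proof.
have sumn0 h : sumn h = 0 -> h = nseq (size h) 0.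
  by elim: h => //= x h IH; case: x => //= /IH {1}->.
elim: p f g => [|s p IH] f g sz /=.
  by move=> /eqP /sumn0 -> /eqP /sumn0 ->; rewrite sz.
case/and3P=> _ /eqP -> fP /and3P[_ /eqP eqs gP].
have := IH _ _ _ fP gP; rewrite !size_shift_tops => /(_ sz).
case: f g sz eqs {fP gP} => [|x f] [|y g] //= [sz]; rewrite /burge_step /= => eqs [eqx sh].
have eq_top: is_top f = is_top g.
  by move: eqs; case: is_top; case: is_top => //; case: x {eqx}; case: y.
rewrite (shift_tops_inj sz) //; congr (_ :: _).
by move: eqs eqx; rewrite eq_top; case: is_top; case: x; case: y => //= n m _ [->].
Qed.

(** A South-East step occurs when site 0 is a top, that is when a part is lost, and all parts are
    lost in the end. *)
Lemma count_SouthEast f p : burge_path f p -> count_mem SouthEast p = sumn f.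
Proof.
elim: p f => [|s p IH] f /=; first by move/eqP.
case/and3P=> _ /eqP -> /IH ->; have := sumn_shift_tops f; rewrite /burge_step.
case: f => //= x f; case: is_top => //=; case: x => //=; lia.
Qed.

(** * Pairs, peaks and the major index *)

Fixpoint nb_tops (f : seq nat) : nat :=
  if f is _ :: f' then is_top f + nb_tops f' else 0.

(** The sum of the i f_i, each part being counted once for every site below it. *)
Fixpoint weight (f : seq nat) : nat :=
  if f is _ :: f' then weight f' + sumn f' else 0.

Lemma weight_shift_tops f :
  weight (shift_tops f) + nb_tops (behead f) = weight f.
Proof.
elim: f => //= x [|y f] //=; have := sumn_shift_tops (y :: f) => /=; lia.
Qed.

(* The tops, moved down by 1, are the sites found when the pairing is done from
   the left, and both pairings have the same number of pairs. *)
Lemma nb_tops_shift_tops f y : 0 < y ->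
  nb_tops (if is_top f then y :: shift_tops f else shift_tops f) = nb_tops f.
Proof.
elim: f y => //= x f IH y y_gt0; have := IH x.+1 isT; have := IH 1 isT.
by case: (is_top f) => /=; case: x => [|x] /=; rewrite ?y_gt0 ?andbT ?andbF //=; lia.
Qed.

Lemma nb_topsS f : 0 < sumn f -> 0 < nb_tops f.
Proof.
elim: f => //= x f IH; case: (posnP (sumn f)) => [f0|/IH]; last lia.
have -> : is_top f = false by apply/negP => /is_top_sumn; lia.
by case: x => //=; lia.
Qed.

(** Termination: [sumn f + weight f] counts a part of site i as i + 1, so each top lowers it by 1, a
    top at site 0 included. *)
Lemma burge_path_exists f : exists p, burge_path f p.
Proof.
move: {2}(sumn f + weight f) (leqnn (sumn f + weight f)) => N.
elim: N f => [|N IH] f leN; first by exists [::] => /=; lia.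
case: (posnP (sumn f)) => [f0|f_gt0]; first by exists [::]; rewrite /= f0.
have [|p pP] := IH (shift_tops f).
  have := sumn_shift_tops f; have := weight_shift_tops f; have := nb_topsS f_gt0.
  by case: f f_gt0 leN => //= x f; lia.
by exists (burge_step f :: p); rewrite /= f_gt0 eqxx.
Qed.

Lemma peaks_cons s p :
  peaks (s :: p) =
  (if (s == NorthEast) && (head East p == SouthEast) then [:: 1] else [::])
  ++ [seq x.+1 | x <- peaks p].
Proof.
rewrite /peaks /= (iotaDl 1 0) filter_map; case: p => [|s' p] /=; first by rewrite andbF.
rewrite {1}/is_peak /=.
have -> : filter (preim (addn 1) (is_peak [:: s, s' & p])) (iota 1 (size p)) =
    filter (is_peak (s' :: p)) (iota 1 (size p)).
  by apply: eq_in_filter => -[|x]; rewrite mem_iota.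
by case: ifP.
Qed.

Lemma nb_tops_le f : nb_tops f <= sumn f.
Proof. by elim: f => //= x f IH; case: is_top; case: x => //=; lia. Qed.

(** After a North-East step site 0 is not empty, and it is a top exactly when the next step is
    South-East, that is when a peak has just been reached. By [nb_tops_shift_tops] this peak
    accounts for the one pair whose top is now at site 0. *)
Lemma size_peaks f p : burge_path f p -> size (peaks p) = nb_tops (behead f).
Proof.
elim: p f => [|s p IH] f /=.
  by move/eqP; have := nb_tops_le (behead f); case: f => //= x f; lia.
case/and3P=> _ /eqP -> pP; rewrite peaks_cons size_cat size_map (IH _ pP).
case: f pP {IH} => [|x f] /=; first by case: p => //=.
have := @nb_tops_shift_tops f x.+1 isT; rewrite /burge_step /=.
case: (boolP (is_top f)) => _ <-; last by case: ltnP => _ _ /=.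
case: p => [|s' p] //= /andP[/eqP -> _].
by rewrite /burge_step /= andbT; case: is_top.
Qed.

(** Removing the first step lowers the abscissa of each peak by 1, while the weight drops by the
    number of pairs with a top above site 0; [size_peaks] equates the two losses. *)
Lemma major_index_burge_path f p : burge_path f p -> major_index p = weight f.
Proof.
elim: p f => [|s p IH] f.
  move=> /eqP f0; rewrite /major_index big_nil; elim: f f0 => //= x f IHf f0.
  by rewrite -IHf; lia.
move=> spP; have /and3P[_ _ /IH pP] := spP.
rewrite -weight_shift_tops -pP -(size_peaks spP) /major_index peaks_cons.
rewrite big_cat size_cat size_map big_map -[size (peaks p)]sum1_size.
rewrite addnCA -big_split /=; under [in RHS]eq_bigr do rewrite addn1.
by case: ifP => _; rewrite ?big_nil ?big_seq1.
Qed.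

(** * Bounds on neighbouring frequencies and on heights *)

Fixpoint pairs_lt (k : nat) (f : seq nat) : bool :=
  if f is x :: f' then (x + head 0 f' < k) && pairs_lt k f' else true.

(** The sum over a pair is unchanged, and so is that of a top and the lower site of the next pair.
    Any other sum of neighbours, before or after, is 0 or at most the sum over a pair, except for a
    top at the first site followed by an empty site, whence the condition on the head. *)
Lemma pairs_lt_shift_tops k f : 0 < k ->
  pairs_lt k f = pairs_lt k (shift_tops f) && (head 0 f < k).
Proof.
move=> k_gt0; elim: f => //= x [|y f] /=; first by case: x => [|x] _ /=; lia.
move=> IH; rewrite IH; case: (is_top f) => /=.
  by case: x => [|x]; case: y {IH} => [|y] /=; case: (pairs_lt k _); case: (shift_tops f) => [|z f'] /=; lia.
by case: y {IH} => [|y] /=; case: x => [|x] /=; case: (pairs_lt k _); lia.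
Qed.

Lemma special_kkE k p :
  special_kk k p = (0 < k) && all (fun y => y < k) (scanl next_height 0 p).
Proof.
rewrite /special_kk /height /= take0 /=; congr (_ && _).
rewrite (iotaDl 1 0) all_map.
suff scanP h : all (fun x => foldl next_height h (take x.+1 p) < k) (iota 0 (size p))
    = all (fun y => y < k) (scanl next_height h p) by apply: scanP.
elim: p h => //= s p IH h; rewrite take0 (iotaDl 1 0) all_map /=; congr (_ && _).
by rewrite -IH.
Qed.

Lemma pairs_lt_burge_path k f p : 0 < k -> burge_path f p ->
  pairs_lt k f =
  (head 0 f < k) && all (fun y => y < k) (scanl next_height (head 0 f) p).
Proof.
move=> k_gt0; elim: p f => [|s p IH] f /=.
  move=> f0; have -> : head 0 f = 0 by case: f f0 => //= x f; lia.
  rewrite k_gt0; elim: f f0 => //= x f IHf f0; rewrite IHf ?andbT; last lia.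
  by case: f f0 {IHf} => //= *; lia.
case/and3P=> _ /eqP -> /IH {}IH; rewrite pairs_lt_shift_tops // IH.
by rewrite next_height_shift_tops andbC.
Qed.

Lemma burge_path_rcons0 f n p :
  burge_path (f ++ nseq n 0) p = burge_path f p.
Proof.
have top0 g : is_top (g ++ nseq n 0) = is_top g.
  by elim: g => /= [|x g ->] //; case: n => //= n; rewrite andbF.
have shift0 g : shift_tops (g ++ nseq n 0) = shift_tops g ++ nseq n 0.
  elim: g => /= [|x g ->]; last by rewrite top0.
  elim: n {top0} => //= n ->; suff -> : is_top (nseq n 0) = false by [].
  by case: n => //= n; rewrite andbF.
have sum0 : sumn (nseq n 0) = 0 by rewrite sumn_nseq.
elim: p f => [|s p IH] f /=; rewrite sumn_cat sum0 addn0 // shift0 IH; congr [&& _, _ & _].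
rewrite /burge_step; case: f => [|x f] /=; last by rewrite top0.
by case: (n) => //= -[|m]; rewrite /= ?andbF.
Qed.

Lemma burge_path_eq f g p : (forall i, nth 0 f i = nth 0 g i) ->
  burge_path f p = burge_path g p.
Proof.
move=> eq_fg; rewrite -(burge_path_rcons0 f (size g - size f)).
rewrite -(burge_path_rcons0 g (size f - size g)); congr burge_path.
apply: (@eq_from_nth _ 0) => [|i _]; first by rewrite !size_cat !size_nseq; lia.
have nth_pad (h : seq nat) m : nth 0 (h ++ nseq m 0) i = nth 0 h i.
  by rewrite nth_cat nth_nseq if_same; case: ltnP => // /(nth_default 0).
by rewrite !nth_pad.
Qed.

(* The inverse of [shift_tops]; [b] tells whether the first site of the result
   has to be a top. *)
Fixpoint unshift_tops (b : bool) (f : seq nat) : seq nat :=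
  if f is x :: f' then
    if b then x.+1 :: unshift_tops false f'
    else if x is x'.+1 then x' :: unshift_tops true f'
    else 0 :: unshift_tops false f'
  else nseq b 1.

Lemma is_top_unshift b f : is_top (unshift_tops b f) = b.
Proof.
elim: f b => [|x f IH] [] //=; first by rewrite IH.
by case: x => [|x] /=; rewrite IH.
Qed.

Lemma shift_unshift_tops b f i :
  nth 0 (shift_tops (unshift_tops b f)) i = nth 0 f i.
Proof.
elim: f b i => [|x f IH] [] //=; [by case => [|[]]| |].
  by rewrite is_top_unshift => -[|i] /=.
by case: x => [|x]; rewrite /= is_top_unshift => -[|i] /=.
Qed.

Lemma sumn_unshift_tops b f : sumn (unshift_tops b f) = sumn f + b.
Proof. by elim: f b => [|x f IH] [] //=; [|case: x => [|x]]; rewrite /= IH; lia. Qed.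

Lemma burge_path_surj p h : legal_from h p -> foldl next_height h p = 0 ->
  (p == [::]) || (last East p == SouthEast) ->
  exists2 f, 0 < size f /\ head 0 f = h & burge_path f p.
Proof.
elim: p h => [|s p IH] h /=; first by move=> _ ->; exists [:: 0].
case/andP=> legal_s legal_p end_p last_p.
have [|[|y f] [//= _ head_f] fP] := IH _ legal_p end_p.
  by case: p last_p {IH legal_p end_p}.
have shiftP b z : head 0 (shift_tops (z :: unshift_tops b f)) = y ->
    burge_path (shift_tops (z :: unshift_tops b f)) p.
  by move=> eq_y; rewrite (burge_path_eq _ (g := y :: f)) // => -[|i] //=; rewrite shift_unshift_tops.
(* An East step requires that parts remain. As it cannot be the last step, the rest is a non-empty
   path, whose configuration has a part. *)
have f_gt0 : (s == SouthEast) || (0 < sumn (y :: f)).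
  by case: p last_p fP {IH legal_p end_p shiftP} => [/= ->|s' p _ /and3P[->]] //; rewrite orbT.
case: s legal_s head_f f_gt0 {IH legal_p end_p last_p} => /=.
- move=> _ eq_y _; exists (h :: unshift_tops true f); rewrite //= is_top_unshift.
  rewrite /burge_step /= is_top_unshift eqxx /=; apply/andP; split.
    by have := @is_top_sumn (unshift_tops true f); rewrite is_top_unshift; lia.
  by have := shiftP true h; rewrite /= is_top_unshift; apply; rewrite eq_y.
- case: h => // h _ /= eq_y _; exists (h.+1 :: unshift_tops false f) => //=.
  rewrite /burge_step /= is_top_unshift /=.
  by have := shiftP false h.+1; rewrite /= is_top_unshift; apply; rewrite eq_y.
move=> /eqP -> eq_y f_gt0; exists (0 :: unshift_tops false f) => //=.
rewrite /burge_step /= is_top_unshift /= sumn_unshift_tops addn0.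
move: f_gt0; rewrite eq_y add0n => -> /=.
by have := shiftP false 0; rewrite /= is_top_unshift; apply; rewrite eq_y.
Qed.

(** * Cluster parities under one step *)

(* [L r] lists the parities of the r-clusters, by increasing parts. The parity
   recorded for a cluster is that of the sum of (part - 1) over its parts, which
   is the opposite of its cluster parity. *)
Definition push (r : nat) (c : bool) (L : nat -> seq bool) : nat -> seq bool :=
  fun s => if s == r then rcons (L s) c else L s.

Definition pop (r : nat) (L : nat -> seq bool) : nat -> seq bool :=
  fun s => if s == r then take (size (L s)).-1 (L s) else L s.

(* An x-marked part extends the last of the (x-1)-clusters. *)
Definition add_mark (b : bool) (L : nat -> seq bool) (x : nat) : nat -> seq bool :=
  if x == 1 then push 1 b L
  else if nilp (L x.-1) then L
  else push x (b (+) last false (L x.-1)) (pop x.-1 L).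

Definition flip (L : nat -> seq bool) : nat -> seq bool := fun s => map negb (L s).

Notation add_marks b := (foldl (add_mark b)).

Lemma take_rcons_pred T (s : seq T) c : take (size (rcons s c)).-1 (rcons s c) = s.
Proof. by rewrite size_rcons /= -cats1 take_size_cat. Qed.

Lemma add_mark_push b r c L : 0 < r ->
  add_mark b (push r c L) r.+1 = push r.+1 (b (+) c) L.
Proof.
move=> r_gt0; rewrite /add_mark eqSS (negPf (lt0n_neq0 r_gt0)).
rewrite /= {1}/push eqxx /nilp size_rcons /=.
apply: functional_extensionality => s; rewrite /push /pop eqxx last_rcons.
case: (s =P r.+1) => [->|_]; first by rewrite !gtn_eqF.
by case: (s =P r) => [->|//]; rewrite take_rcons_pred.
Qed.

Lemma add_mark_pushC b r c L x : x != r -> x.-1 != r ->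
  add_mark b (push r c L) x = push r c (add_mark b L x).
Proof.
move=> xr x1r; rewrite /add_mark {2 3}/push (negPf x1r).
case: eqP => [x1|_]; last case: ifP => // _.
  apply: functional_extensionality => s; rewrite /push.
  by case: (s =P r); case: (s =P 1) => // s1 sr; exfalso; lia.
apply: functional_extensionality => s; rewrite /push /pop.
by case: (s =P x) => [->|_]; [|case: (s =P x.-1) => [->|//]];
   rewrite ?(negPf xr) ?(negPf x1r).
Qed.

(** The exchange of clusters: when the last two r-clusters have the same parity c, extending one or
    the other leaves the same lists. *)
Lemma add_mark_push_last b r c L s : 0 < r -> L r = rcons s c ->
  add_mark b (push r c L) r.+1 = push r c (add_mark b L r.+1).
Proof.
move=> r_gt0 Lr; rewrite add_mark_push // /add_mark eqSS (negPf (lt0n_neq0 r_gt0)).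
rewrite /= Lr /nilp size_rcons /=; apply: functional_extensionality => u.
rewrite /push /pop last_rcons; case: (u =P r) => [->|_]; last by case: eqP.
by rewrite ltn_eqF // Lr take_rcons_pred.
Qed.

Lemma flip_push r c L : flip (push r c L) = push r (~~ c) (flip L).
Proof.
apply: functional_extensionality => s; rewrite /flip /push.
by case: ifP; rewrite ?map_rcons.
Qed.

(** A mark other than 1 adds b to a parity already recorded, which commutes with negation, whereas a
    mark 1 records b itself. *)
Lemma flip_add_mark b L x : x != 1 -> flip (add_mark b L x) = add_mark b (flip L) x.
Proof.
move=> x1; rewrite /add_mark (negPf x1) {2}/flip /nilp size_map.
case: ifP => // /negbT L0; rewrite flip_push; congr push.
  by rewrite /flip; case/lastP: (L x.-1) L0 => // s c _; rewrite map_rcons !last_rcons addbN.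
apply: functional_extensionality => s; rewrite /flip /pop.
by case: ifP; rewrite ?map_take ?size_map.
Qed.

Lemma flip_add_marks b L A : 1 \notin A -> flip (add_marks b L A) = add_marks b (flip L) A.
Proof.
elim: A L => //= x A IH L; rewrite inE negb_or eq_sym => /andP[x1 /IH ->].
by rewrite flip_add_mark.
Qed.

Lemma add_mark_id b r L x : r != x -> r != x.-1 -> add_mark b L x r = L r.
Proof.
move=> rx rx1; rewrite /add_mark /push /pop; case: eqP => [x1|_].
  by rewrite -x1 (negPf rx).
by case: ifP => // _; rewrite (negPf rx) (negPf rx1).
Qed.

Lemma add_marks_id b r L A : all (fun x => r.+1 < x) A -> add_marks b L A r = L r.
Proof.
by elim: A L => //= x A IH L /andP[rx /IH ->]; rewrite add_mark_id //; lia.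
Qed.

Lemma add_marks_pushC b r c L A : all (fun x => r.+1 < x) A ->
  add_marks b (push r c L) A = push r c (add_marks b L A).
Proof.
by elim: A L => //= x A IH L /andP[rx rA]; rewrite add_mark_pushC ?IH //; lia.
Qed.

(** As A increases, only its first mark can be r + 1, the one mark that extends r-clusters. *)
Lemma add_marks_push_last b r c L A : 0 < r -> sorted ltn A -> all (fun x => r < x) A ->
  (r.+1 \in A -> exists s, L r = rcons s c) ->
  add_marks b (push r c L) A = push r c (add_marks b L A).
Proof.
case: A => //= x A r_gt0 xA /andP[rx rA] Lr.
have {}xA : all (fun y => r.+1 < y) A.
  by apply/allP => y /(allP (order_path_min ltn_trans xA)); lia.
case: (x =P r.+1) Lr => [-> Lr|xr _]; last by rewrite add_mark_pushC ?add_marks_pushC //; lia.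
by have [|s Ls] := Lr _; rewrite ?mem_head // (add_mark_push_last _ _ Ls) ?add_marks_pushC.
Qed.

Lemma add_marks_iota b m L :
  add_marks b L (iota 1 m) = if m is 0 then L else push m (odd m && b) L.
Proof.
elim: m => // m IH; rewrite -[m.+1]addn1 iotaD foldl_cat IH /= add1n addn1.
by case: m {IH} => [|m]; rewrite ?add_mark_push //=; congr push; case: (odd m); case: b.
Qed.

(* The marks [V] of the parts of size i, given those, [U], of the parts of size
   i - 1. *)
Definition site_marks (U V : seq nat) : Prop :=
  [/\ sorted ltn V, 0 \notin V, {in V, forall x, x \notin U}
    & {in V, forall x y, 0 < y < x -> y \in U ++ V}].

Fixpoint marks_from (U : seq nat) (Us : seq (seq nat)) : Prop :=
  if Us is V :: Us' then site_marks U V /\ marks_from V Us' else True.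

(* Below, [nxt] is the least mark of the site that follows the list if this site
   is a top, and [None] otherwise. *)
Fixpoint top_mark (nxt : option nat) (Us : seq (seq nat)) : option nat :=
  if Us is U :: Us' then
    if top_mark nxt Us' is Some _ then None else ohead U
  else nxt.

Definition insert_mark (x : nat) (U : seq nat) : seq nat :=
  iota 1 x ++ [seq y <- U | x < y].

(* The least mark of a top is the least mark missing at the site below. *)
Fixpoint shift_marks (nxt : option nat) (Us : seq (seq nat)) : seq (seq nat) :=
  if Us is U :: Us' then
    (if top_mark nxt Us' is Some x then insert_mark x U else behead U)
      :: shift_marks nxt Us'
  else [::].

(* [b] is the parity of i - 1, where i is the first site. *)
Fixpoint sites_clusters (b : bool) (L : nat -> seq bool) (Us : seq (seq nat)) :=
  if Us is U :: Us' then sites_clusters (~~ b) (add_marks b L U) Us' else L.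

Lemma sorted_iota_filter m x U : m <= x -> sorted ltn U ->
  sorted ltn (iota 1 m ++ [seq y <- U | x < y]).
Proof.
move=> le_mx sU; rewrite (sorted_pairwise ltn_trans) pairwise_cat.
rewrite -!(sorted_pairwise ltn_trans) iota_ltn_sorted sorted_filter //=; last exact: ltn_trans.
rewrite andbT; apply/allrelP => y z; rewrite mem_iota mem_filter; lia.
Qed.

Lemma sorted_cons_min x U y : sorted ltn (x :: U) -> y \in U -> x < y.
Proof. by move=> /(order_path_min ltn_trans)/allP; apply. Qed.

(** The marks below x have to occur in one of the two sites, and x is the least mark of the upper
    one, so they all occur in U. *)
Lemma site_marks_split U x V : sorted ltn U -> 0 \notin U -> site_marks U (x :: V) ->
  U = iota 1 x.-1 ++ [seq y <- U | x < y].
Proof.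
move=> sU U0 [sV V0 UV VU]; apply: (irr_sorted_eq ltn_trans ltnn) => //.
  by apply: sorted_iota_filter; rewrite ?leq_pred.
have x_gt0 : 0 < x by rewrite lt0n; apply: contraNneq V0 => ->; rewrite mem_head.
move=> y; rewrite mem_cat mem_iota mem_filter.
have xU : x \notin U by apply: UV; rewrite mem_head.
case: (ltngtP x y) => [lt_xy|lt_yx|<-] /=; last by rewrite (negPf xU); lia.
  by case: (y \in U); lia.
rewrite orbF; apply/idP/idP => [yU|y_lt].
  by have : y != 0 by [apply: contraNneq U0 => <-]; lia.
have := VU x (mem_head _ _) y; rewrite mem_cat inE => /(_ _)/orP[|//|/orP[]].
- by lia.
- by lia.
- by move/(sorted_cons_min sV); lia.
Qed.

Section LowerHalf.
Variables (U0 U : seq nat) (x : nat) (V : seq nat) (b : bool) (L : nat -> seq bool).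
Hypotheses (sU0 : sorted ltn U0) (U00 : 0 \notin U0) (U0U : site_marks U0 U).
Hypothesis UV : site_marks U (x :: V).

Let A := [seq y <- U | x < y].

Lemma site_marks_gt0 : 0 < x.
Proof. by case: UV => _ V0 _ _; rewrite lt0n; apply: contraNneq V0 => ->; rewrite mem_head. Qed.

(** The marks 1, ..., x - 1 of U form one cluster, completed by x. The larger marks of U, read in
    between, only touch clusters of length at least x. *)
Lemma add_marks_split : add_mark (~~ b) (add_marks b L U) x =
  push x (~~ (odd x && b)) (add_marks b L A).
Proof.
case: U0U => sU U_0 _ _; rewrite (site_marks_split sU U_0 UV) -/A foldl_cat add_marks_iota.
have A_gt : all (fun y => x < y) A by apply/allP => y; rewrite mem_filter => /andP[].
move: (A) A_gt site_marks_gt0 => A'; case: (x) => [//|[|m]] A_gt _ //=.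
rewrite add_marks_pushC // add_mark_push //.
by congr push; rewrite /=; case: (odd m); case: b.
Qed.

(** The two sides read the marks in a different order, which matters only if x + 1 is in U: it
    extends the new x-cluster on the left and an older one on the right. Then x must be in U0, and
    it is its least mark because U contains 1, ..., x - 1 and is disjoint from U0; the hypothesis
    thus gives the parity of the older cluster. *)
Lemma add_marks_insert :
  (forall y W, U0 = y :: W -> y.+1 \notin U0 -> exists s, L y = rcons s (~~ (odd y && b))) ->
  add_marks b (flip L) (insert_mark x U) = flip (add_mark (~~ b) (add_marks b L U) x).
Proof.
move=> LU0; rewrite add_marks_split flip_push negbK /insert_mark -/A foldl_cat add_marks_iota.
case: U0U => sU U_0 UU0 UU; have := site_marks_gt0; case def_x: (x) => [//|m] _; rewrite -def_x.
have A_gt y : y \in A -> x < y by rewrite mem_filter => /andP[].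
rewrite add_marks_push_last ?flip_add_marks //.
- by apply: contraTN isT => /A_gt; have := site_marks_gt0; lia.
- exact: site_marks_gt0.
- by apply: sorted_filter => //; exact: ltn_trans.
- by apply/allP.
move=> x1A; have x1U : x.+1 \in U by move: x1A; rewrite mem_filter => /andP[].
have xU : x \notin U by case: UV => _ _ H _; apply: H; rewrite mem_head.
have xU0 : x \in U0.
  have := UU _ x1U x; rewrite mem_cat (negPf xU) orbF; apply.
  by have := site_marks_gt0; lia.
have x1U0 : x.+1 \notin U0 by apply: UU0.
case: (U0) LU0 xU0 x1U0 sU0 U00 UU0 => // y W LU0 xU0 x1U0 syW yW0 UyW.
have eq_yx : y = x.
  move: xU0; rewrite inE => /predU1P[-> //|/(sorted_cons_min syW) lt_yx].
  have : y \in U.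
    rewrite (site_marks_split sU U_0 UV) mem_cat mem_iota.
    by move: yW0; rewrite inE negb_or => /andP[]; lia.
  by move/UyW; rewrite mem_head.
have [|s Ls] := LU0 _ _ erefl; first by rewrite {1}eq_yx.
exists (map negb s); rewrite /flip -eq_yx Ls map_rcons negbK.
by [].
Qed.

End LowerHalf.

(* Each cluster loses 1. A cluster of the pair (i - 1, i) may get reattached when
   the least mark x of i moves to i - 1, where x + 1 is present: then the last
   x-cluster is exchanged with the one ending at i, and the last hypothesis says
   that they have the same parity. *)
Lemma sites_clusters_shift nxt U0 b L Us :
  sorted ltn U0 -> 0 \notin U0 -> marks_from U0 Us -> top_mark nxt Us = None ->
  (forall x, nxt = Some x -> exists V, site_marks (last U0 Us) (x :: V)) ->
  (forall x V, U0 = x :: V -> x.+1 \notin U0 -> exists s, L x = rcons s (~~ (odd x && b))) ->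
  sites_clusters b (flip L) (shift_marks nxt Us) =
  flip (if nxt is Some x then add_mark (b (+) odd (size Us)) (sites_clusters b L Us) x
        else sites_clusters b L Us).
Proof.
have [n] := ubnP (size Us); elim: n => // n IH in U0 b L Us *.
case: Us => [|U Us] lt_n sU0 U00 => [_ /= -> //|/= [U0U UUs]].
(* With no top just above it, U is not a top either, hence it is empty. *)
case top_Us: (top_mark nxt Us) => [x|]; last first.
  case: U lt_n U0U UUs => // lt_n U0U UUs _ nxtP _ /=.
  by rewrite (IH [::]) // addbN -addNb.
move=> nxt0 nxtP LU0; have [sU U_0 _ _] := U0U.
case: Us UUs top_Us nxtP lt_n => [|U1 Us] /= UUs.
  move=> -> nxtP _; have [V UV] := nxtP _ erefl.
  by rewrite (add_marks_insert sU0 U00 U0U UV LU0) addbT.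
case top_Us: (top_mark nxt Us) => [//|].
case: U1 UUs => // x1 V + [eq_x]; rewrite eq_x => -[UV VUs] nxtP lt_n.
rewrite (add_marks_insert sU0 U00 U0U UV LU0) /=.
have [sV V_0 _ _] := UV.
rewrite -flip_add_marks; last first.
  by apply: contraTN isT => /(sorted_cons_min sV); have := site_marks_gt0 UV; lia.
(* The hypothesis on parities is restored for the site [x :: V]: by [add_marks_split] the x-cluster
   just completed is the last one, and without x + 1 in V no mark of V extends it. *)
rewrite (IH (x :: V)) //; [|by lia|]; last first.
  move=> _ _ [<- _] x1V; rewrite negbK (add_marks_split b L U0U UV).
  rewrite add_marks_id; last first.
    apply/allP => y yV; have := sorted_cons_min sV yV; move: x1V; rewrite inE negb_or.
    by case/andP=> _ x1V; have : y != x.+1 by [apply: contraNneq x1V => <-]; lia.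
  by rewrite {1}/push eqxx; eexists.
by rewrite !negbK.
Qed.

(** * Reading the cluster parities along the path *)

Lemma least_unusedP u :
  [/\ 0 < least_unused u, least_unused u \notin u
    & forall y, 0 < y < least_unused u -> y \in u].
Proof.
rewrite /least_unused; set p := fun r => r.+1 \notin u; set s := iota 0 _.
have has_p : has p s.
  apply/negPn/negP; rewrite -all_predC => /allP all_u.
  have /uniq_leq_size : uniq [seq r.+1 | r <- s].
    by rewrite map_inj_uniq ?iota_uniq // => ? ? [].
  move=> /(_ u); rewrite size_map size_iota ltnn => le_u.
  by suff: false by []; apply: le_u => _ /mapP[r /all_u + ->]; rewrite /= negbK.
have lt_find : find p s < (size u).+1 by rewrite -[X in _ < X](size_iota 0) -has_find.
split=> //; first by have := nth_find 0 has_p; rewrite nth_iota.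
move=> [//|y]; rewrite !ltnS => lt_y; have := before_find 0 lt_y; rewrite nth_iota; last by lia.
by move/negbFE.
Qed.

Opaque least_unused.

Lemma least_unused_eq x u : 0 < x -> x \notin u ->
  (forall y, 0 < y < x -> y \in u) -> least_unused u = x.
Proof.
move=> x_gt0 xu ltx; have [l_gt0 lu ltl] := least_unusedP u.
case: (ltngtP (least_unused u) x) => // lt.
  by rewrite ltx ?l_gt0 in lu.
by rewrite ltl ?x_gt0 in xu.
Qed.

Section Site.
Variables (U : seq nat) (x : nat) (V : seq nat).
Hypotheses (sU : sorted ltn U) (U_0 : 0 \notin U) (UV : site_marks U (x :: V)).

Lemma mem_insert_mark y : (y \in insert_mark x U) = (y == x) || (y \in U).
Proof.
have := site_marks_gt0 UV.
rewrite {2}(site_marks_split sU U_0 UV) !mem_cat !mem_iota; lia.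
Qed.

Lemma size_insert_mark : size (insert_mark x U) = (size U).+1.
Proof.
rewrite {2}(site_marks_split sU U_0 UV) !size_cat !size_iota.
by have := site_marks_gt0 UV; lia.
Qed.

Lemma least_unused_site : least_unused U = x.
Proof.
case: UV => sV V_0 dUV VU; apply: least_unused_eq.
- exact: site_marks_gt0 UV.
- by apply: dUV; rewrite mem_head.
move=> y lt_y; have := VU x (mem_head _ _) y lt_y; rewrite mem_cat inE.
by case/orP=> // /predU1P[eq_y|/(sorted_cons_min sV)]; lia.
Qed.

(** The site below loses its least mark h while U gains x. All marks below x are in U, hence not in
    U0, so h is at least x. If a larger mark of U relied on h, then x, being absent from U, would
    have to be in U0, so that h = x, which is the mark gained. *)
Lemma site_marks_insert U0 : sorted ltn U0 -> 0 \notin U0 -> site_marks U0 U ->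
  site_marks (behead U0) (insert_mark x U).
Proof.
move=> sU0 U00 [_ _ dU0U UU].
have lt_xU y : 0 < y < x -> y \in U.
  by move=> lt_y; rewrite (site_marks_split sU U_0 UV) mem_cat mem_iota; lia.
have xU : x \notin U by case: UV => _ _ H _; apply: H; rewrite mem_head.
split.
- by apply: sorted_iota_filter.
- by rewrite mem_insert_mark negb_or U_0 andbT; have := site_marks_gt0 UV; lia.
- move=> y; rewrite mem_insert_mark => /predU1P[->|/dU0U]; last first.
    by apply: contra; apply: mem_behead.
  case: (U0) sU0 U00 dU0U => //= h W shW hW0 dhU; apply/negP => /(sorted_cons_min shW) lt_hx.
  have h_gt0 : 0 < h by rewrite lt0n eq_sym; move: hW0; rewrite inE negb_or => /andP[].
  by have := dhU h (lt_xU h _); rewrite h_gt0 mem_head => /(_ lt_hx).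
move=> z; rewrite mem_insert_mark => zP w lt_wz; rewrite mem_cat mem_insert_mark.
case/predU1P: zP => [eq_z|zU].
  by rewrite lt_xU ?orbT // -eq_z.
have := UU z zU w lt_wz; rewrite mem_cat; case/orP => [|->]; last by rewrite !orbT.
case: (U0) sU0 U00 dU0U UU => //= h W shW _ dhU UU.
rewrite inE => /predU1P[eq_w|->//]; case: (w =P x) => [|wx]; first by rewrite !orbT.
have : x \in (h :: W) ++ U.
  apply: (UU z zU); rewrite (site_marks_gt0 UV) /=; suff: ~~ (w < x) by lia.
  apply/negP => lt_wx; have := dhU w; rewrite lt_xU ?eq_w ?mem_head; last by lia.
  by move/(_ isT).
rewrite mem_cat (negPf xU) orbF inE => /predU1P[xh|xW]; first by lia.
have := sorted_cons_min shW xW; rewrite -eq_w => lt_wx.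
have := dhU w; rewrite lt_xU ?eq_w ?mem_head; last by lia.
by move/(_ isT).
Qed.

Lemma site_marks_behead : site_marks (insert_mark x U) V.
Proof.
case: UV => sV V_0 dUV VU; split.
- exact: path_sorted sV.
- by move: V_0; rewrite inE negb_or => /andP[].
- move=> y yV; rewrite mem_insert_mark negb_or dUV ?andbT ?inE ?yV ?orbT //.
  by have := sorted_cons_min sV yV; lia.
move=> z zV w lt_wz; rewrite mem_cat mem_insert_mark.
have zxV : z \in x :: V by rewrite inE zV orbT.
by have := VU z zxV w lt_wz; rewrite mem_cat inE orbA [_ || (w == x)]orbC.
Qed.

End Site.

Lemma marks_from_shift nxt U0 Us :
  sorted ltn U0 -> 0 \notin U0 -> marks_from U0 Us -> top_mark nxt Us = None ->
  (forall x, nxt = Some x -> exists V, site_marks (last U0 Us) (x :: V)) ->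
  marks_from (behead U0) (shift_marks nxt Us).
Proof.
have [n] := ubnP (size Us); elim: n => // n IH in U0 Us *.
case: Us => [|U Us] lt_n sU0 U00 => [//|/= [U0U UUs]].
have [sU U_0 _ _] := U0U.
case top_Us: (top_mark nxt Us) => [x|]; last first.
  case: U lt_n U0U UUs {sU U_0} => // lt_n U0U UUs _ nxtP /=.
  by split=> //; apply: (IH [::]).
move=> _ nxtP; case: Us UUs top_Us nxtP lt_n => [|U1 Us] /= UUs.
  move=> eq_nxt nxtP _; have [V UV] := nxtP _ eq_nxt.
  by split=> //; apply: site_marks_insert UV _ sU0 U00 U0U.
case top_Us: (top_mark nxt Us) => [//|].
case: U1 UUs => // x1 V + [eq_x]; rewrite eq_x => -[UV VUs] nxtP lt_n.
split; first exact: site_marks_insert UV _ sU0 U00 U0U.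
split; first exact: site_marks_behead UV.
have [sV V_0 _ _] := UV.
by apply: (IH (x :: V)) => //; lia.
Qed.

Lemma is_top_size Us : is_top (map size Us) = top_mark None Us :> bool.
Proof. by elim: Us => //= U Us ->; case: top_mark => //=; case: U. Qed.

Lemma top_mark_site U Us x : marks_from U Us -> top_mark None Us = Some x ->
  exists V, site_marks U (x :: V).
Proof.
case: Us => //= V Us [UV _]; case: top_mark => //.
by case: V UV => //= y V UV [<-]; exists V.
Qed.

Lemma map_size_shift_marks U Us : marks_from U Us ->
  map size (shift_marks None Us) = shift_tops (map size Us).
Proof.
elim: Us U => //= V Us IH U [UV VUs]; rewrite (IH _ VUs) is_top_size.
have [sV V_0 _ _] := UV; case def_x: top_mark => [x|] /=; last by rewrite size_behead.
by have [W VW] := top_mark_site VUs def_x; rewrite (size_insert_mark _ _ VW).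
Qed.

Lemma size_shift_marks nxt Us : size (shift_marks nxt Us) = size Us.
Proof. by elim: Us => //= U Us ->. Qed.

Lemma top_mark_cat nxt Us Vs : top_mark nxt (Us ++ Vs) = top_mark (top_mark nxt Vs) Us.
Proof. by elim: Us => //= U Us ->. Qed.

Lemma shift_marks_cat nxt Us Vs :
  shift_marks nxt (Us ++ Vs) = shift_marks (top_mark nxt Vs) Us ++ shift_marks nxt Vs.
Proof. by elim: Us => //= U Us ->; rewrite top_mark_cat. Qed.

Lemma marks_from_cat U Us Vs :
  marks_from U (Us ++ Vs) <-> marks_from U Us /\ marks_from (last U Us) Vs.
Proof. by elim: Us U => [|V Us IH] U /=; [|rewrite IH]; tauto. Qed.

Lemma sites_clusters_nil b L Us : sumn (map size Us) = 0 -> sites_clusters b L Us = L.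
Proof. by elim: Us b => //= -[|//] Us IH b; rewrite add0n => /IH. Qed.

Lemma sites_clusters_cat b L Us Vs :
  sites_clusters b L (Us ++ Vs) =
  sites_clusters (b (+) odd (size Us)) (sites_clusters b L Us) Vs.
Proof.
by elim: Us b L => [|U Us IH] b L /=; rewrite ?addbF // IH addbN addNb.
Qed.

(* The first component of a state holds the marks at site 0, whose number is the
   height of the path; the second one describes the clusters of the parts that
   are at most 0, as seen from the present time. *)
Definition scan_step (st : seq nat * (nat -> seq bool)) (s : step) :=
  match s with
  | NorthEast => let x := least_unused st.1 in
                 (insert_mark x st.1, flip (add_mark false st.2 x))
  | _ => (behead st.1, flip st.2)
  end.

Definition no_clusters : nat -> seq bool := fun=> [::].

(** [P], [V] and [Q] hold the marks of the negative sites, of site 0 and of the positive sites. The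
    first site is the opposite of [size P], which explains b. When the path ends, [Q] holds no part,
    so the clusters up to site 0 are all of them. *)
Lemma scan_burge_path P V Q p (b := ~~ odd (size P)) :
  marks_from [::] (rcons P V ++ Q) -> burge_path (size V :: map size Q) p ->
  foldl scan_step (V, sites_clusters b no_clusters (rcons P V)) p =
  ([::], iter (size p) flip (sites_clusters b no_clusters (rcons P V ++ Q))).
Proof.
elim: p => [|s p IH] in P V Q b *.
  move=> _ /eqP /=; case: V => //; rewrite add0n => Q0.
  by rewrite sites_clusters_cat [in RHS]sites_clusters_nil.
move=> PVQ /= /and3P[_ /eqP eq_s pP].
set nxt := top_mark None Q.
pose V' := if nxt is Some x then insert_mark x V else behead V.
(* An empty site is added at the bottom before each shift, so that no part is ever lost. *)
have def_P' : exists2 P', shift_marks nxt ([::] :: rcons P V) = rcons P' V' & size P' = (size P).+1.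
  exists (shift_marks (top_mark nxt [:: V]) ([::] :: P)).
    by rewrite -cats1 -cat_cons shift_marks_cat cats1.
  by rewrite /= size_shift_marks.
have [P' eqP' szP'] := def_P'.
have := PVQ; rewrite marks_from_cat last_rcons => -[PV VQ].
have [sV V_0] : sorted ltn V /\ 0 \notin V.
  by move: PV; rewrite -cats1 marks_from_cat => -[_ [[]]].
have nxtP x : nxt = Some x -> exists W, site_marks (last [::] ([::] :: rcons P V)) (x :: W).
  by rewrite /= last_rcons; apply: top_mark_site.
have top_None o Us : top_mark o ([::] :: Us) = None by rewrite /=; case: top_mark.
have def_b : ~~ odd (size P') = ~~ b by rewrite szP'.
have flip0 : flip no_clusters = no_clusters by [].
have P'V'Q' : marks_from [::] (rcons P' V' ++ shift_marks None Q).
  rewrite -eqP' -shift_marks_cat.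
  by apply: (@marks_from_shift None [::]) => //; rewrite top_None.
have full : sites_clusters (~~ b) no_clusters (rcons P' V' ++ shift_marks None Q) =
    flip (sites_clusters b no_clusters (rcons P V ++ Q)).
  rewrite -eqP' -shift_marks_cat -{1}flip0 (@sites_clusters_shift None [::]) //=.
    by rewrite negbK.
  by case: top_mark.
(* The mark x comes from site 1, for which i - 1 is even, whence [false]; the flip accounts for its
   move to site 0. *)
have part : sites_clusters (~~ b) no_clusters (rcons P' V') =
    flip (if nxt is Some x then add_mark false (sites_clusters b no_clusters (rcons P V)) x
          else sites_clusters b no_clusters (rcons P V)).
  rewrite -eqP' -{1}flip0 (@sites_clusters_shift nxt [::]) //=; last by case: top_mark.
  by rewrite negbK size_rcons /= negbK /b; case: nxt {nxtP eqP' V' def_P' P'V'Q' full} => // x; case: odd.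
have := IH P' V' (shift_marks None Q) P'V'Q'.
rewrite def_b part full -iterSr => <-; last first.
  move: pP; rewrite /= is_top_size -/nxt (map_size_shift_marks VQ) /V'.
  by case def_x: nxt => [x|]; [have [W VW] := top_mark_site VQ def_x; rewrite (size_insert_mark _ _ VW) | rewrite size_behead].
congr foldl; rewrite eq_s /burge_step /= is_top_size -/nxt /V'.
case def_x: nxt => [x|] /=; last by case: ltnP.
by have [W VW] := top_mark_site VQ def_x; rewrite (least_unused_site _ _ VW).
Qed.

(** * The scan inside an excursion *)

(* The marks r in U with r + 1 not in U end a cluster; if the marks 1, ..., r are
   in U then this cluster consists of r parts 0, whence its parity. *)
Definition scan_inv (U : seq nat) (L : nat -> seq bool) : Prop :=
  [/\ sorted ltn U, 0 \notin U
    & {in U, forall r, r.+1 \notin U ->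
        exists s, L r = rcons s (odd (count (leq^~ r) U))}].

Lemma least_unused_site_marks U : site_marks U [:: least_unused U].
Proof.
have [l_gt0 lU ltl] := least_unusedP U; split=> //.
- by move=> x; rewrite inE => /eqP ->.
by move=> x; rewrite inE => /eqP -> y /ltl yU; rewrite mem_cat yU.
Qed.

Lemma perm_insert_least U : sorted ltn U -> 0 \notin U ->
  perm_eq (insert_mark (least_unused U) U) (least_unused U :: U).
Proof.
move=> sU U_0; have Ul := least_unused_site_marks U.
apply: uniq_perm => [||y]; last by rewrite (mem_insert_mark sU U_0 Ul) inE.
- exact/(sorted_uniq ltn_trans ltnn)/sorted_iota_filter.
- rewrite /= (sorted_uniq ltn_trans ltnn) // andbT.
  by have [] := least_unusedP U.
Qed.

Lemma count_least_unused U : sorted ltn U -> 0 \notin U ->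
  count (leq^~ (least_unused U).-1) U = (least_unused U).-1.
Proof.
move=> sU U_0; have [l_gt0 _ _] := least_unusedP U.
rewrite {2}(site_marks_split sU U_0 (least_unused_site_marks U)) count_cat.
rewrite (eq_in_count (a2 := predT)) ?count_predT ?size_iota; last first.
  by move=> y; rewrite mem_iota /=; lia.
rewrite (eq_in_count (a2 := pred0)) ?count_pred0 ?addn0 //.
by move=> y; rewrite mem_filter => /andP[lt_y _]; apply/negbTE; rewrite -ltnNge; lia.
Qed.

Lemma scan_inv_last U L : scan_inv U L -> 1 < least_unused U ->
  exists s, L (least_unused U).-1 = rcons s (odd (least_unused U).-1).
Proof.
case=> sU U_0 UL l_gt1; have [_ lU ltl] := least_unusedP U.
have := UL (least_unused U).-1; rewrite count_least_unused // prednK; last by lia.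
by apply=> //; apply: ltl; lia.
Qed.

Lemma flip_rcons L r s c : L r = rcons s c -> flip L r = rcons (map negb s) (~~ c).
Proof. by rewrite /flip => ->; rewrite map_rcons. Qed.

(** When the parities flip, the number of marks up to r changes by 1: the mark removed or added is
    below any other r that ends a cluster, since r < x would put r + 1 in the new set. For r = x,
    the new cluster extends the one formed by 1, ..., x - 1. *)
Lemma scan_inv_step U L s : scan_inv U L ->
  scan_inv (scan_step (U, L) s).1 (scan_step (U, L) s).2.
Proof.
move=> inv; have := scan_inv_last inv; case: inv => sU U_0 UL.
have scan_behead : scan_inv (behead U) (flip L).
  case: U sU U_0 UL => [|h W] //= shW hW0 WL; split=> /=.
  - exact: path_sorted shW.
  - by move: hW0; rewrite inE negb_or => /andP[].
  move=> r rW r1W; have lt_hr := sorted_cons_min shW rW.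
  have [||s' Ls] := WL r; rewrite ?inE ?rW ?orbT // ?negb_or ?r1W ?andbT; first by lia.
  exists (map negb s'); rewrite (flip_rcons Ls) /= ltnW //.
  by rewrite add1n /= negbK.
case: s => //= lastP; have [l_gt0 lU ltl] := least_unusedP U.
have mem_ins := mem_insert_mark sU U_0 (least_unused_site_marks U).
have := permP (perm_insert_least sU U_0); set x := least_unused U in lastP l_gt0 lU ltl mem_ins * => count_ins.
split.
- by apply: sorted_iota_filter.
- by rewrite mem_ins negb_or U_0 andbT; lia.
move=> r; rewrite !mem_ins negb_or => r_in /andP[r1x r1U]; rewrite count_ins /=.
case/predU1P: r_in => [->|rU].
  rewrite leqnn /=.
  have count_x : count (leq^~ x) U = x.-1.
    rewrite -[RHS](count_least_unused sU U_0) -/x; apply: eq_in_count => y yU /=.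
    have : y != x by apply: contraNneq lU => <-.
    by lia.
  rewrite count_x /add_mark; case: eqP => [x1|/eqP x1].
    by exists (map negb (L 1)); rewrite /flip /push x1 /= map_rcons.
  have [|s Ls] := lastP; first by lia.
  rewrite Ls /nilp size_rcons /= last_rcons; exists (map negb (L x)).
  rewrite /flip /push /pop eqxx; case: eqP => [|_]; first by lia.
  by rewrite map_rcons; congr rcons; rewrite -[in RHS](prednK l_gt0).
have lt_xr : x < r.
  case: ltngtP r1U => // [lt_rx|eq_xr]; last by rewrite eq_xr rU in lU.
  by rewrite ltl //; lia.
have [s Ls] := UL r rU r1U; exists (map negb s).
have -> : flip (add_mark false L x) r = flip L r.
  by rewrite /flip add_mark_id //; lia.
by rewrite (flip_rcons Ls) ltnW.
Qed.

(** * Clusters completed before an excursion *)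

Definition cat_clusters (L0 L : nat -> seq bool) : nat -> seq bool :=
  fun r => L0 r ++ L r.

Lemma flip_cat_clusters L0 L :
  flip (cat_clusters L0 L) = cat_clusters (flip L0) (flip L).
Proof. by apply: functional_extensionality => r; rewrite /flip /cat_clusters map_cat. Qed.

Lemma add_mark_cat b L0 L x : x = 1 \/ ~~ nilp (L x.-1) ->
  add_mark b (cat_clusters L0 L) x = cat_clusters L0 (add_mark b L x).
Proof.
move=> Lx; rewrite /add_mark; case: eqP Lx => [x1 _|_ [//|Lx]].
  apply: functional_extensionality => r; rewrite /cat_clusters /push.
  by case: eqP => // ->; rewrite rcons_cat.
have catN : nilp (cat_clusters L0 L x.-1) = false.
  by rewrite /cat_clusters /nilp size_cat; move: Lx; rewrite /nilp; lia.
rewrite catN (negPf Lx); apply: functional_extensionality => r.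
have take_cat_pred (s t : seq bool) : ~~ nilp t ->
    take (size (s ++ t)).-1 (s ++ t) = s ++ take (size t).-1 t.
  by case/lastP: t => // t c _; rewrite -rcons_cat !take_rcons_pred.
have last_cat_clusters : last false (cat_clusters L0 L x.-1) = last false (L x.-1).
  rewrite /cat_clusters; case/lastP: (L x.-1) Lx => // t c _.
  by rewrite -rcons_cat !last_rcons.
rewrite last_cat_clusters /cat_clusters /push /pop.
case: (r =P x) => [->|_]; case: eqP => [->|_]; rewrite ?take_cat_pred ?rcons_cat //.
Qed.

(** By the invariant, a cluster extended by a North-East step is listed in L, so those of L0 are
    only flipped. *)
Lemma scan_cat L0 U L p : scan_inv U L ->
  foldl scan_step (U, cat_clusters L0 L) p =
  ((foldl scan_step (U, L) p).1,
   cat_clusters (iter (size p) flip L0) (foldl scan_step (U, L) p).2).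
Proof.
elim: p L0 U L => [|s p IH] L0 U L // inv; have := scan_inv_step s inv.
rewrite [iter _ _ _]iterSr /=; have -> : scan_step (U, cat_clusters L0 L) s =
    ((scan_step (U, L) s).1, cat_clusters (flip L0) (scan_step (U, L) s).2).
  case: s => /=; rewrite ?flip_cat_clusters // add_mark_cat ?flip_cat_clusters //.
  have [l_gt0 _ _] := least_unusedP U; case: (ltngtP (least_unused U) 1) => [|l_gt1|]; [by lia| |by left].
  by right; have [s ->] := scan_inv_last inv l_gt1; rewrite /nilp size_rcons.
by case: (scan_step (U, L) s) => U' L' /= /IH ->.
Qed.

(* Compares the states (U, L) and (U', L') reached when reading an excursion from
   level 0 and from level 1: all relative heights agree, except that the leftmost
   highest peak, of relative height w - 1, gets relative height w. *)
Definition coupled (w : nat) (U U' : seq nat) (L L' : nat -> seq bool) : Prop :=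
  [/\ 0 < w, U' = rcons U w, all (ltn^~ w) U,
      exists2 k, L w.-1 = nseq k (odd (size U)) & (1 < w) = (0 < k)
    & (forall r, w <= r -> L r = [::]) /\
      L' = fun r => if r == w then [:: ~~ odd (size U)]
                    else if r == w.-1 then behead (L r) else L r].

Lemma size_insert_least U : sorted ltn U -> 0 \notin U ->
  size (insert_mark (least_unused U) U) = (size U).+1.
Proof. by move=> sU U_0; rewrite (size_insert_mark sU U_0 (least_unused_site_marks U)). Qed.

Lemma insert_mark_rcons x U w : x < w -> insert_mark x (rcons U w) = rcons (insert_mark x U) w.
Proof. by move=> lt_xw; rewrite /insert_mark filter_rcons lt_xw -rcons_cat. Qed.

Lemma coupled_behead w U U' L L' : U != [::] -> coupled w U U' L L' ->
  coupled w (behead U) (behead U') (flip L) (flip L').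
Proof.
case: U => //= x U _ [w_gt0 -> /= /andP[_ Uw] [k Lw wk] [L0 ->]]; split=> //.
  by exists k; rewrite // /flip Lw map_nseq negbK.
split=> [r /L0|]; first by rewrite /flip => ->.
apply: functional_extensionality => r; rewrite /flip.
by case: (r == w); rewrite /= ?negbK //; case: (r == w.-1); rewrite ?behead_map.
Qed.

Lemma add_markE b L x r : 0 < x -> x = 1 \/ ~~ nilp (L x.-1) ->
  add_mark b L x r =
  if r == x then rcons (L x) (b (+) last false (if x == 1 then [::] else L x.-1))
  else if (r == x.-1) && (x != 1) then take (size (L r)).-1 (L r) else L r.
Proof.
move=> x_gt0 Lx; rewrite /add_mark; case: (x =P 1) Lx => [-> _|x1 [//|/negPf ->]].
  by rewrite /push addbF andbF; case: (r =P 1) => // ->.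
rewrite /push /pop andbT; case: (r =P x) => // ->.
by rewrite gtn_eqF // prednK.
Qed.

Lemma last_nseq T (x : T) k : last x (nseq k x) = x.
Proof. by elim: k. Qed.

(** Either U consists of 1, ..., w - 1, and then U gains w, U' gains w + 1, and w + 1 takes over the
    role of w; or the same mark, less than w, enters both. *)
Lemma coupled_NorthEast w U U' L L' : scan_inv U L -> coupled w U U' L L' ->
  exists w', coupled w' (insert_mark (least_unused U) U) (insert_mark (least_unused U') U')
    (flip (add_mark false L (least_unused U))) (flip (add_mark false L' (least_unused U'))).
Proof.
move=> inv [w_gt0 def_U' Uw [k Lw wk] [L0 def_L']].
have [sU U_0 _] := inv; have [l_gt0 lU ltl] := least_unusedP U.
have le_lw : least_unused U <= w.
  rewrite leqNgt; apply/negP => lt_wl; have /ltl /(allP Uw) /= : 0 < w < least_unused U by lia.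
  by rewrite ltnn.
have lastP : least_unused U = 1 \/ ~~ nilp (L (least_unused U).-1).
  case: (ltngtP (least_unused U) 1) => [|l_gt1|]; [by lia| |by left].
  by right; have [s ->] := scan_inv_last inv l_gt1; rewrite /nilp size_rcons.
have szI := size_insert_least sU U_0.
have def_U x : x = least_unused U -> w <= x.+1 -> U = iota 1 x.-1.
  move=> eq_x le_wx; rewrite {1}(site_marks_split sU U_0 (least_unused_site_marks U)) -eq_x.
  rewrite (eq_in_filter (a2 := pred0)) ?filter_pred0 ?cats0 // => y /(allP Uw) /=; lia.
have [eq_lw|lt_lw] : least_unused U = w \/ least_unused U < w by lia.
  have {}def_U : U = iota 1 w.-1 by apply: def_U.
  have lU' : least_unused U' = w.+1.
    by apply: least_unused_eq => // [|y lt_y]; rewrite def_U' mem_rcons inE def_U mem_iota; lia.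
  have ins_iota x : 0 < x -> insert_mark x (iota 1 x.-1) = iota 1 x.
    move=> x_gt0; rewrite /insert_mark (eq_in_filter (a2 := pred0)) ?filter_pred0 ?cats0 //.
    by move=> y; rewrite mem_iota => lt_y; apply/negbTE; lia.
  have iota1S x : iota 1 x.+1 = rcons (iota 1 x) x.+1 by rewrite -[x.+1]addn1 iotaD cats1 add1n addn1.
  have U'_iota : U' = iota 1 w.
    by rewrite def_U' def_U -[in RHS](prednK w_gt0) iota1S prednK.
  exists w.+1; rewrite lU' eq_lw def_U U'_iota ins_iota // (ins_iota w.+1) // iota1S.
  have L'w : L' w = [:: ~~ odd w.-1] by rewrite def_L' eqxx def_U size_iota.
  rewrite eq_lw in lastP.
  have addL r : flip (add_mark false L w) r =
      if r == w then [:: odd w] else if r == w.-1 then flip L' r else flip L r.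
    rewrite /flip (add_markE false _ w_gt0 lastP) L0 //=; case: (r =P w) => [_|rw].
      case: (w =P 1) => [-> //|w1]; rewrite Lw def_U size_iota -[in RHS](prednK w_gt0) /=.
      by case: k wk {Lw} => [|k] wk; [lia|rewrite /= last_nseq].
    case: (r =P w.-1) => //= ->; congr map.
    have -> : L' w.-1 = behead (L w.-1) by rewrite def_L' ltn_eqF ?prednK // eqxx.
    rewrite Lw; case: (w =P 1) => [w1|_]; case: k wk {Lw} => [|k] wk //=; first by lia.
    by rewrite size_nseq (@take_nseq _ k k.+1).
  split=> //.
  - by apply/allP => y; rewrite mem_iota /=; lia.
  - by exists 1 => //; rewrite addL eqxx size_iota.
  split=> [r lt_wr|]; first by rewrite addL !gtn_eqF // /flip ?L0 //; lia.
  apply: functional_extensionality => r.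
  rewrite {1}/flip add_markE ?L'w //=; last by right.
  case: (r =P w.+1) => [_|rw].
    have -> : L' w.+1 = [::] by rewrite def_L' !gtn_eqF ?L0 //; lia.
    by rewrite eqSS gtn_eqF //= size_iota -[in RHS](prednK w_gt0) /= negbK.
  have -> : w.+1 != 1 by rewrite eqSS; lia.
  case: (r =P w) => [->|/eqP rw']; first by rewrite addL eqxx L'w.
  rewrite /= addL (negPf rw'); case: (r =P w.-1) => // /eqP rw1.
  by rewrite def_L' (negPf rw') (negPf rw1).
have lU' : least_unused U' = least_unused U.
  apply: least_unused_eq => // [|y /ltl yU]; rewrite def_U' mem_rcons inE ?yU ?orbT //.
  by rewrite negb_or lU; lia.
exists w; rewrite lU' def_U' insert_mark_rcons //; split=> //.
- apply/allP => y; rewrite (mem_insert_mark sU U_0 (least_unused_site_marks U)).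
  by case/predU1P=> [-> //|/(allP Uw)].
(* If the mark w - 1 enters, there is one more (w-1)-cluster. Its parity agrees with the others
   because U then consists of 1, ..., w - 2. *)
- case: (w.-1 =P least_unused U) => [eq_x|/eqP neq_x]; last first.
    exists k => //; rewrite /flip add_mark_id //; last by lia.
    by rewrite Lw szI map_nseq.
  exists k.+1; last by lia.
  have -> : flip (add_mark false L (least_unused U)) w.-1 =
      map negb (rcons (nseq k (odd (size U))) (odd (size U))).
    rewrite /flip add_markE // -eq_x eqxx Lw; congr map; congr rcons.
    have -> : size U = w.-1.-1 by rewrite (def_U _ eq_x) ?size_iota ?prednK.
    case: (w.-1 =P 1) => [-> //|x1].
    have [|s] := scan_inv_last inv; first by lia.
    by rewrite -eq_x => ->; rewrite last_rcons.
  by rewrite -cats1 -(nseqD k 1) addn1 map_nseq szI.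
split=> [r le_wr|]; first by rewrite /flip add_mark_id ?L0 //; lia.
apply: functional_extensionality => r; rewrite szI.
case: (r =P w) => [->|/eqP rw].
  by rewrite /flip add_mark_id ?def_L' ?eqxx //; lia.
have L'x1 : L' (least_unused U).-1 = L (least_unused U).-1.
  by rewrite def_L' !ltn_eqF //; lia.
rewrite /flip !add_markE ?L'x1 //.
have L'w1 : L' w.-1 = behead (L w.-1) by rewrite def_L' ltn_eqF ?prednK // eqxx.
case: (r =P w.-1) => [eq_r|/eqP rw1]; last first.
  have L'r : L' r = L r by rewrite def_L' (negPf rw) (negPf rw1).
  by case: eqP => [eq_x|_]; rewrite -?eq_x L'r.
case: (r =P least_unused U) => [eq_x|/eqP neq_x].
  rewrite -eq_x eq_r L'w1 Lw; case: k wk {Lw} => [|k] wk //.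
  by move: l_gt0; rewrite -eq_x eq_r; lia.
have -> : r == (least_unused U).-1 = false by lia.
by rewrite eq_r L'w1 behead_map.
Qed.

(** * Relative heights *)

Definition closed_path (p : seq step) : bool :=
  legal_from 0 p && (foldl next_height 0 p == 0).

Lemma heightS p x : x < size p -> height p x.+1 = next_height (height p x) (nth East p x).
Proof. by move=> lt_x; rewrite /height (take_nth East lt_x) -cats1 foldl_cat. Qed.

Lemma height_oversize p x : size p <= x -> height p x = height p (size p).
Proof. by move=> le_x; rewrite /height !take_oversize. Qed.

Lemma heightS_le p x : height p x.+1 <= (height p x).+1.
Proof.
have [lt_x|le_x] := ltnP x (size p); last by rewrite !(@height_oversize p) //; lia.
by rewrite heightS //; case: nth => /=; lia.
Qed.

Lemma heightS_ge p x : height p x <= (height p x.+1).+1.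
Proof.
have [lt_x|le_x] := ltnP x (size p); last by rewrite !(@height_oversize p) //; lia.
by rewrite heightS //; case: nth => /=; lia.
Qed.

(** Discrete intermediate values: a step changes the height by at most 1. *)
Lemma height_down p a b c : a <= b -> height p b <= c <= height p a ->
  exists2 x, a <= x <= b & height p x = c.
Proof.
move=> le_ab; rewrite -(subnKC le_ab); elim: (b - a) => [|d IH].
  by rewrite addn0 => lt_c; exists a; lia.
rewrite addnS => /andP[le_c le_ca].
have [lt_c|ge_c] := ltnP c (height p (a + d)).
  by exists (a + d).+1; have := heightS_ge p (a + d); lia.
by have [|x lt_x <-] := IH; [lia|exists x; lia].
Qed.

Lemma height_up p a b c : a <= b -> height p a <= c <= height p b ->
  exists2 x, a <= x <= b & height p x = c.
Proof.
move=> le_ab; rewrite -(subnKC le_ab); elim: (b - a) => [|d IH].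
  by rewrite addn0 => lt_c; exists a; lia.
rewrite addnS => /andP[le_c le_ca].
have [lt_c|ge_c] := leqP c (height p (a + d)).
  by have [|x lt_x <-] := IH; [lia|exists x; lia].
by exists (a + d).+1; have := heightS_le p (a + d); lia.
Qed.

Definition is_prominence (p : seq step) (x h : nat) : Prop :=
  exists x' x'', [/\ x' < x < x'', x'' <= size p,
    height p x' = height p x - h, height p x'' = height p x - h
    & {in peaks p, forall z, x' < z < x'' ->
        height p z <= height p x /\ (height p z = height p x -> x <= z)}].

(** Verbatim the condition under the maximum in [relative_height], so that [change] can expose
    it. *)
Definition prominence (p : seq step) (x h : nat) : bool :=
  let y := height p x in
  [exists x' : 'I_(size p).+1, exists x'' : 'I_(size p).+1,
      [&& x' < x < x'', height p x' == y - h, height p x'' == y - h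
        & all (fun z => (height p z <= y) && ((height p z == y) ==> (x <= z)))
              [seq z <- peaks p | x' < z < x'']]].

Lemma prominenceP p x h : reflect (is_prominence p x h) (prominence p x h).
Proof.
apply: (iffP existsP) => [[x' /existsP[x'']]|].
  case/and4P=> lt_x /eqP hx' /eqP hx'' /allP allz; exists x', x''; split=> //.
    by rewrite -ltnS.
  move=> z zp lt_z; have := allz z; rewrite mem_filter lt_z zp => /(_ isT)/andP[-> /implyP].
  by move=> hz; split=> // /eqP.
case=> x' [x'' [lt_x le_x'' hx' hx'' allz]].
have lt_x' : x' < (size p).+1 by lia.
exists (Ordinal lt_x'); apply/existsP; rewrite -ltnS in le_x''.
exists (Ordinal le_x''); rewrite /= hx' hx'' lt_x !eqxx /=.
apply/allP => z; rewrite mem_filter => /andP[lt_z /allz/(_ lt_z)[-> hz]].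
by apply/implyP => /eqP.
Qed.

(** The candidate h = 0 contributes nothing to the maximum, so positive h suffice. *)
Lemma relative_height_eq p q x x' : height p x = height q x' ->
  (forall h, 0 < h <= height p x -> is_prominence p x h <-> is_prominence q x' h) ->
  relative_height p x = relative_height q x'.
Proof.
move=> eq_y eq_P.
change (\max_(h < (height p x).+1 | prominence p x h) h =
        \max_(h < (height q x').+1 | prominence q x' h) h).
rewrite -eq_y big_mkcond [RHS]big_mkcond /=.
apply: eq_bigr => -[[|h] lt_h] _; first by rewrite !if_same.
by congr (if _ then _ else _); apply/prominenceP/prominenceP => /eq_P; apply; rewrite -ltnS.
Qed.

Lemma relative_height_le p x : relative_height p x <= height p x.
Proof. by apply/bigmax_leqP => h _; rewrite -ltnS. Qed.

Lemma relative_height_max p x : is_prominence p x (height p x) ->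
  relative_height p x = height p x.
Proof.
move/prominenceP => hx; apply/eqP; rewrite eqn_leq relative_height_le /=.
by apply: (leq_bigmax_cond (Ordinal (ltnSn (height p x)))).
Qed.

(** * Concatenation of closed paths *)

Lemma height_cat_l p q x : x <= size p -> height (p ++ q) x = height p x.
Proof.
move=> le_x; rewrite /height take_cat; case: ltnP => // le_px.
by have -> : x = size p; [lia|rewrite subnn take0 take_size cats0].
Qed.

Lemma height_cat_r p q x : closed_path p -> height (p ++ q) (size p + x) = height q x.
Proof.
by case/andP=> _ /eqP p0; rewrite /height take_cat ltnNge leq_addr addKn foldl_cat p0.
Qed.

Lemma height_size p : closed_path p -> height p (size p) = 0.
Proof. by case/andP=> _ /eqP; rewrite /height take_size. Qed.

Lemma is_peak_cat_l p q x : x < size p -> is_peak (p ++ q) x = is_peak p x.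
Proof. by move=> lt_x; rewrite /is_peak !nth_cat lt_x (leq_ltn_trans (leq_pred x)). Qed.

Lemma is_peak_cat_r p q x : closed_path p -> is_peak (p ++ q) (size p + x) = is_peak q x.
Proof.
move=> closed_p; rewrite /is_peak !nth_cat [size p + x < _]ltnNge leq_addr addKn /=.
case: x => [|x].
  (* There is no peak at the junction: a path that comes back to height 0 does not end with a
     North-East step. *)
  rewrite addn0; case/lastP: p closed_p => // p s /andP[_].
  by rewrite size_rcons leqnn /= nth_rcons ltnn eqxx -cats1 foldl_cat /=; case: s.
by rewrite addnS /= ltnNge leq_addr addKn.
Qed.

Lemma peaks_cat p q : closed_path p ->
  peaks (p ++ q) = peaks p ++ [seq size p + x | x <- peaks q].
Proof.
move=> closed_p; rewrite /peaks size_cat iotaD filter_cat add0n; congr (_ ++ _).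
  by apply: eq_in_filter => x; rewrite mem_iota => lt_x; rewrite is_peak_cat_l.
rewrite -[X in iota X]addn0 iotaDl filter_map; congr map.
by apply: eq_filter => x /=; rewrite is_peak_cat_r.
Qed.

Lemma mem_peaks p x : (x \in peaks p) = is_peak p x.
Proof.
rewrite mem_filter mem_iota /= add0n andb_idr // => /and3P[_ _].
by case: ltnP => // le_x; rewrite nth_default.
Qed.

Lemma is_peak_lt p x : is_peak p x -> x < size p.
Proof. by rewrite -mem_peaks mem_filter mem_iota => /andP[_]. Qed.

(** A right witness beyond [p] can be pulled back into [p]: the height comes down to 0 at the end of
    [p], passing through the level of the witness. *)
Lemma relative_height_cat_l p q x : closed_path p -> x < size p ->
  relative_height (p ++ q) x = relative_height p x.
Proof.
move=> closed_p lt_x; have hx := height_cat_l q (ltnW lt_x).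
apply: relative_height_eq => // h; rewrite hx => h_gt0.
split=> -[x' [x'' [lt_x'' le_x'' hx' hx'' allz]]]; rewrite ?hx in hx' hx'' allz.
  have [b lt_b hb] : exists2 b, x < b <= x'' /\ b <= size p & height p b = height p x - h.
    have [le_p|lt_p] := leqP x'' (size p).
      by exists x''; [rewrite le_p leqnn; case/andP: lt_x'' => _ ->|rewrite -hx'' height_cat_l].
    have [||b lt_b hb] := @height_down p x (size p) (height p x - h); first exact: ltnW.
      by rewrite height_size // leq_subr.
    exists b => //; have : b != x by apply: contraTneq isT => eq_b; rewrite eq_b in hb; lia.
    by clear -lt_b lt_p; lia.
  exists x', b; split; rewrite // -?(@height_cat_l p q x') //; try lia.
  move=> z; rewrite mem_peaks => zp lt_z; have := is_peak_lt zp => lt_zp.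
  by have := allz z; rewrite mem_peaks is_peak_cat_l // zp height_cat_l ?(ltnW lt_zp) //; apply=> //; lia.
exists x', x''; split; rewrite ?size_cat ?hx //; try by rewrite height_cat_l //; lia.
  by lia.
move=> z; rewrite mem_peaks => zp lt_z; have lt_zp : z < size p by lia.
by rewrite (height_cat_l _ (ltnW lt_zp)); apply: allz; rewrite // mem_peaks -(is_peak_cat_l q).
Qed.

Lemma relative_height_cat_r p q x : closed_path p ->
  relative_height (p ++ q) (size p + x) = relative_height q x.
Proof.
move=> closed_p; have hq z := @height_cat_r p q z closed_p.
apply: relative_height_eq => // h; rewrite hq => h_gt0.
split=> -[x' [x'' [lt_x'' le_x'' hx' hx'' allz]]]; rewrite ?hq in hx' hx'' allz.
  have [a lt_a ha] : exists2 a, a < x /\ x' <= size p + a & height q a = height q x - h.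
    have [le_p|lt_p] := leqP (size p) x'.
      by exists (x' - size p); rewrite -1?hq subnKC //; split; [clear -lt_x'' le_p; lia|].
    have [//||a lt_a ha] := @height_up q 0 x (height q x - h).
      by rewrite /height take0 leq_subr.
    exists a => //; have : a != x by apply: contraTneq isT => eq_a; rewrite eq_a in ha; lia.
    by clear -lt_a lt_p; lia.
  exists a, (x'' - size p); split=> //.
  - by clear -lt_a lt_x''; lia.
  - by rewrite size_cat in le_x''; clear -le_x''; lia.
  - by rewrite -hq subnKC //; clear -lt_x''; lia.
  move=> z; rewrite mem_peaks => zp lt_z; rewrite -!hq.
  have := allz (size p + z); rewrite mem_peaks is_peak_cat_r // zp !hq => /(_ isT)[|-> hz].
    by clear -lt_z lt_a; lia.
  by split=> // /hz; rewrite leq_add2l.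
exists (size p + x'), (size p + x''); rewrite size_cat !hq !ltn_add2l leq_add2l; split=> //.
move=> z; rewrite mem_peaks => + lt_z; have -> : z = size p + (z - size p) by lia.
rewrite is_peak_cat_r // !hq => zp.
have [||-> hz] := allz (z - size p); rewrite ?mem_peaks //; first by clear -lt_z; lia.
by split=> // /hz; rewrite leq_add2l.
Qed.

(** * Raising a path by one level *)

Definition lift_path (p : seq step) : seq step := NorthEast :: rcons p SouthEast.

Lemma foldl_next_heightS h p : East \notin p -> legal_from h p ->
  foldl next_height h.+1 p = (foldl next_height h p).+1.
Proof.
elim: p h => //= s p IH h; rewrite inE negb_or => /andP[Es Ep] /andP[legal_s legal_p].
by rewrite -IH //; congr foldl; case: s Es legal_s {legal_p} => //=; case: h.
Qed.

Lemma legal_fromS h p : East \notin p -> legal_from h p -> legal_from h.+1 p.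
Proof.
elim: p h => //= s p IH h; rewrite inE negb_or => /andP[Es Ep] /andP[legal_s legal_p].
have -> : next_height h.+1 s = (next_height h s).+1 by case: s Es legal_s {legal_p} => //=; case: h.
by rewrite IH //; case: s Es {legal_s legal_p}.
Qed.

Lemma legal_take h p x : legal_from h p -> legal_from h (take x p).
Proof. by rewrite -{1}(cat_take_drop x p) legal_from_cat => /andP[]. Qed.

Section Lift.
Variable p : seq step.
Hypotheses (closed_p : closed_path p) (Ep : East \notin p).

Lemma lift_closed : closed_path (lift_path p).
Proof.
case/andP: closed_p => legal_p /eqP p0.
rewrite /closed_path /lift_path -cats1 /= legal_from_cat foldl_cat legal_fromS //.
by rewrite foldl_next_heightS // p0.
Qed.

Lemma height_lift x : x <= size p -> height (lift_path p) x.+1 = (height p x).+1.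
Proof.
case/andP: closed_p => legal_p _ le_x.
rewrite /height /lift_path /= -cats1 takel_cat // foldl_next_heightS ?legal_take //.
by apply: contra Ep; apply: mem_take.
Qed.

Lemma height_lift_end : height (lift_path p) (size p).+2 = 0.
Proof.
have := height_size lift_closed; by rewrite /lift_path /= size_rcons.
Qed.

Lemma peaks_lift : p != [::] -> peaks (lift_path p) = [seq x.+1 | x <- peaks p].
Proof.
case/andP: closed_p => legal_p /eqP p0 pn0.
have peaks_rcons : peaks (rcons p SouthEast) = peaks p.
  rewrite -cats1 peaks_cat // cats0 //.
rewrite /lift_path peaks_cons peaks_rcons.
by case: (p) legal_p pn0 => [|[]] //.
Qed.

(** Witnesses at a positive level are those of [p], raised. Level 0 is met only at the two ends, so
    h = y + 1 is admissible exactly when x is the leftmost highest of all peaks. *)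
Lemma relative_height_lift x (y := height p x) : is_peak p x ->
  relative_height (lift_path p) x.+1 =
  if all (fun z => (height p z <= y) && ((height p z == y) ==> (x <= z))) (peaks p)
  then y.+1 else relative_height p x.
Proof.
move=> xp; have lt_x := is_peak_lt xp; have hx : height (lift_path p) x.+1 = y.+1.
  by rewrite height_lift // ltnW.
have p_n0 : p != [::] by case: (p) lt_x.
have szlift : size (lift_path p) = (size p).+2 by rewrite /= size_rcons.
have mem_lift z : (z.+1 \in peaks (lift_path p)) = (z \in peaks p).
  by rewrite peaks_lift // mem_map // => ? ? [].
have prom_lift h : 0 < h <= y -> is_prominence (lift_path p) x.+1 h <-> is_prominence p x h.
  move=> h_gt0; split=> -[x' [x'' [lt_x'' le_x'' hx' hx'' allz]]].
    rewrite hx in hx' hx''.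
    have x'_gt0 : 0 < x' by case: x' hx' {lt_x'' allz} => //; rewrite /height take0 /=; lia.
    have lt_x''p : x'' < (size p).+2.
      rewrite szlift in le_x''; suff: x'' != (size p).+2 by lia.
      by apply: contraTneq isT => eq_x''; rewrite eq_x'' height_lift_end in hx''; lia.
    exists x'.-1, x''.-1; rewrite -/y; split; try lia.
    - by have := @height_lift x'.-1; rewrite prednK // hx'; lia.
    - by have := @height_lift x''.-1; rewrite prednK; lia.
    move=> z zp lt_z; have := allz z.+1; rewrite mem_lift zp => /(_ isT).
    rewrite hx height_lift; last by move: zp; rewrite mem_peaks => /is_peak_lt; lia.
    by case=> [|le_z eq_z]; [lia|split; [|move=> /(congr1 succn)/eq_z]; lia].
  exists x'.+1, x''.+1; rewrite hx szlift !height_lift; try lia.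
  split; rewrite ?hx' ?hx'' -/y; try lia.
  case=> // z; rewrite mem_lift => zp lt_z; rewrite height_lift.
    by have [|le_z eq_z] := allz z zp; [lia|split; [|case=> /eq_z]; lia].
  by move: zp; rewrite mem_peaks => /is_peak_lt; lia.
have -> : all (fun z => (height p z <= y) && ((height p z == y) ==> (x <= z))) (peaks p) =
    prominence (lift_path p) x.+1 y.+1.
  apply/allP/prominenceP => [allz|].
    exists 0, (size p).+2; rewrite hx height_lift_end szlift subnn /height take0.
    split=> //; first by lia.
    case=> // z; rewrite mem_lift => zp lt_z; rewrite -!/(height _ _) height_lift.
      by have /andP[le_z /implyP eq_z] := allz z zp; split; [lia|case=> /eqP/eq_z; lia].
    by move: zp; rewrite mem_peaks => /is_peak_lt; lia.
  case=> x' [x'' [lt_x'' le_x'' hx' hx'' allz]] z zp.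
  rewrite hx subnn in hx' hx''.
  have lt_zp : z < size p by move: zp; rewrite mem_peaks => /is_peak_lt.
  have eq_x' : x' = 0.
    by case: x' hx' lt_x'' {allz} => // x' + lt_x''; rewrite height_lift; lia.
  have eq_x'' : x'' = (size p).+2.
    apply/eqP; rewrite eqn_leq -szlift le_x'' szlift ltnNge; apply/negP => le_x''p.
    by have := @height_lift x''.-1; rewrite prednK; lia.
  have := allz z.+1; rewrite mem_lift zp hx height_lift ?(ltnW lt_zp) // => /(_ isT)[|].
    by lia.
  by move=> le_z eq_z; apply/andP; split=> //; apply/implyP => /eqP e; apply: (eq_z (congr1 succn e)).
have relE : relative_height (lift_path p) x.+1 =
    maxn (relative_height p x) (if prominence (lift_path p) x.+1 y.+1 then y.+1 else 0).
  change (\max_(h < (height (lift_path p) x.+1).+1 | prominence (lift_path p) x.+1 h) h =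
    maxn (\max_(h < y.+1 | prominence p x h) h) (if prominence (lift_path p) x.+1 y.+1 then y.+1 else 0)).
  rewrite hx big_mkcond big_ord_recr /= [in RHS]big_mkcond /=; congr maxn.
  apply: eq_bigr => -[[|h] lt_h] _; first by rewrite !if_same.
  by congr (if _ then _ else _); apply/prominenceP/prominenceP => /prom_lift; apply; rewrite -ltnS.
rewrite relE; case: ifP => _; last by rewrite maxn0.
by apply/maxn_idPr/leqW/relative_height_le.
Qed.

End Lift.

(** [A] is what the path does before it first comes down to height h. *)
Lemma first_return h q : legal_from h.+1 q -> foldl next_height h.+1 q = 0 ->
  exists A B, [/\ q = A ++ SouthEast :: B, closed_path A, East \notin A,
    legal_from h B & foldl next_height h B = 0].
Proof.
have [n] := ubnP (size q); elim: n => // n IH in h q *.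
case: q => [|[] q] //= lt_n; first last.
- by move=> legal_q q0; exists [::], q.
(* After a North-East step the path has to come down twice, so the induction hypothesis is applied
   at two successive levels. *)
move=> legal_q q0.
have [//|A1 [B1 [eq_q closed_A1 EA1 legal_B1 B10]]] := IH _ _ _ legal_q q0.
have [|A2 [B [eq_B1 closed_A2 EA2 legal_B B0]]] := IH _ _ _ legal_B1 B10.
  by move: lt_n; rewrite eq_q size_cat /=; lia.
exists (NorthEast :: A1 ++ SouthEast :: A2), B; split=> //.
- by rewrite eq_q eq_B1 /= -catA.
- have := lift_closed closed_A1 EA1; rewrite /lift_path -cats1 /closed_path /=.
  case/andP: closed_A2 => legal_A2 A20.
  rewrite !legal_from_cat !foldl_cat /= => /andP[/and3P[-> ->]].
  by move=> _ /eqP ->; rewrite legal_A2.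
by rewrite inE mem_cat inE !negb_or EA1 EA2.
Qed.

(** * The scan of a closed path lists its peaks *)

Lemma leftmost_max (T : eqType) (f : T -> nat) (s : seq T) : s != [::] ->
  exists s1 z s2, [/\ s = s1 ++ z :: s2, all (fun x => f x < f z) s1
                    & all (fun x => f x <= f z) s2].
Proof.
elim: s => // x s IH _; have [->|/IH[s1 [z [s2 [-> lt_s1 le_s2]]]]] := eqVneq s [::].
  by exists [::], x, [::].
have [lt_xz|le_zx] := ltnP (f x) (f z).
  by exists (x :: s1), z, s2; rewrite /= lt_xz.
exists [::], x, (s1 ++ z :: s2); split=> //; rewrite all_cat /= le_zx /=.
apply/andP; split; apply/allP => y; first by move/(allP lt_s1) => /= lt_y; rewrite (leq_trans (ltnW lt_y)).
by move/(allP le_s2) => /= le_y; rewrite (leq_trans le_y).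
Qed.

(** What the scan has to return. As it flips all parities at each step, those of the peaks are seen
    from the end of the path, hence the term [size p]. *)
Definition path_clusters (p : seq step) : nat -> seq bool :=
  fun r => [seq odd (size p + x + relative_height p x)
             | x <- peaks p & relative_height p x == r].

Lemma iter_flip n L r : iter n flip L r = map (addb (odd n)) (L r).
Proof.
elim: n => [|n IH] /=; first by rewrite map_id.
by rewrite /flip IH -map_comp; apply: eq_map => b /=; rewrite addNb.
Qed.

Lemma path_clusters_cat p q : closed_path p ->
  path_clusters (p ++ q) =
  cat_clusters (iter (size q) flip (path_clusters p)) (path_clusters q).
Proof.
move=> closed_p; apply: functional_extensionality => r.
rewrite /cat_clusters iter_flip /path_clusters peaks_cat // filter_cat map_cat filter_map -!map_comp.
congr (_ ++ _); last first.
  under eq_filter => x /= do rewrite relative_height_cat_r //.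
  apply: eq_map => x /=; rewrite relative_height_cat_r // size_cat !oddD.
  by case: (odd (size p)); case: (odd (size q)); case: odd; case: odd.
under eq_in_filter => x xp do rewrite relative_height_cat_l ?(is_peak_lt _) -?mem_peaks //.
apply/eq_in_map => x; rewrite mem_filter => /andP[_ xp] /=.
rewrite relative_height_cat_l ?(is_peak_lt _) -?mem_peaks // size_cat !oddD.
by case: (odd (size p)); case: (odd (size q)); case: odd; case: odd.
Qed.

Lemma sum_relative_height_cat p q : closed_path p ->
  \sum_(x <- peaks (p ++ q)) relative_height (p ++ q) x =
  \sum_(x <- peaks p) relative_height p x + \sum_(x <- peaks q) relative_height q x.
Proof.
move=> closed_p; rewrite peaks_cat // big_cat big_map /=; congr (_ + _).
  rewrite big_seq [RHS]big_seq; apply: eq_bigr => x; rewrite mem_peaks => /is_peak_lt lt_x.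
  by rewrite relative_height_cat_l.
by apply: eq_bigr => x _; rewrite relative_height_cat_r.
Qed.

Lemma sorted_peaks p : sorted ltn (peaks p).
Proof. by apply: sorted_filter; [exact: ltn_trans|exact: iota_ltn_sorted]. Qed.

Lemma peaks_neq_nil h p : East \notin p -> legal_from h.+1 p ->
  foldl next_height h.+1 p = 0 -> peaks (NorthEast :: p) != [::].
Proof.
elim: p h => //= s p IH h; rewrite inE negb_or => /andP[Es Ep] /andP[_ legal_p] p0.
rewrite peaks_cons; case: s Es legal_p p0 => //= _ legal_p p0.
by have := IH h.+1 Ep legal_p p0; case: (peaks _).
Qed.

(** For the leftmost highest peak z, the ends of the path are witnesses at level 0, so its relative
    height is its height. Hence z is also the leftmost peak of greatest relative height, that is the
    first entry of its list, which is the one that [coupled] removes. *)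
Lemma lift_relative_height p : closed_path p -> East \notin p -> p != [::] ->
  exists s1 z s2 (H := relative_height p z),
    [/\ peaks p = s1 ++ z :: s2, all (fun x => relative_height p x < H) s1,
        all (fun x => relative_height p x <= H) s2, 0 < H
      & {in peaks p, forall x, relative_height (lift_path p) x.+1 =
           relative_height p x + (x == z)}].
Proof.
move=> closed_p Ep p_n0; have [legal_p /eqP p0] := andP closed_p.
have pk_n0 : peaks p != [::].
  case: p closed_p Ep p_n0 legal_p p0 => // -[] p _ //=.
  by rewrite inE /= => Ep _ legal_p p0; apply: (@peaks_neq_nil 0).
have [s1 [z [s2 [eq_pk lt_s1 le_s2]]]] := leftmost_max (height p) pk_n0.
have zp : z \in peaks p by rewrite eq_pk mem_cat mem_head orbT.
have : pairwise ltn (s1 ++ z :: s2).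
  by rewrite -eq_pk -(sorted_pairwise ltn_trans) sorted_peaks.
rewrite pairwise_cat /=.
case/and4P=> /allrelP lt_s1z _ /allP lt_zs2 _.
have le_z x : x \in peaks p -> height p x <= height p z /\ (height p x = height p z -> z <= x).
  rewrite eq_pk mem_cat inE => /or3P[/(allP lt_s1)|/eqP ->|x_s2] /=; [lia|lia|].
  by split; [apply: (allP le_s2)|have := lt_zs2 x x_s2; rewrite /=; lia].
have relz : relative_height p z = height p z.
  apply: relative_height_max; exists 0, (size p).
  move: zp; rewrite mem_peaks => zp; rewrite height_size // /height take0 subnn; split=> //.
    by rewrite (is_peak_lt zp); case/and3P: zp => ->.
  by move=> x xp _; apply: le_z.
have Hz_gt0 : 0 < height p z.
  move: zp; rewrite mem_peaks => /and3P[z_gt0 /eqP NEz _].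
  have [lt_z|le_z'] := ltnP z.-1 (size p); last by rewrite nth_default in NEz.
  by rewrite -(prednK z_gt0) heightS // NEz.
exists s1, z, s2; rewrite relz; split=> //.
- by apply/allP => x /(allP lt_s1) /=; apply: leq_ltn_trans (relative_height_le _ _).
- by apply/allP => x /(allP le_s2) /=; apply: leq_trans (relative_height_le _ _).
move=> x xp; rewrite relative_height_lift // -?mem_peaks //.
case: (x =P z) => [->|neq_xz].
  rewrite relz addn1; case: allP => // -[] t tp; have [-> eq_z] := le_z t tp.
  by apply/implyP => /eqP.
rewrite addn0; case: allP => // /(_ z zp) /andP[le_zx /implyP le_xz].
have [le_x eq_x] := le_z x xp; have eq_xz : height p x = height p z by lia.
by exfalso; have := eq_x eq_xz; have := le_xz (introT eqP (esym eq_xz)); lia.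
Qed.

Lemma sum_relative_height_lift p : closed_path p -> East \notin p ->
  \sum_(x <- peaks (lift_path p)) relative_height (lift_path p) x =
  (\sum_(x <- peaks p) relative_height p x).+1.
Proof.
move=> closed_p Ep; have [->|p_n0] := eqVneq p [::].
  have -> : peaks (lift_path [::]) = [:: 1] by [].
  rewrite big_seq1 big_nil relative_height_max //.
  exists 0, 2; by split=> // z; rewrite inE => /eqP -> _; split.
have [s1 [z [s2 [eq_pk _ _ _ rel_lift]]]] := lift_relative_height closed_p Ep p_n0.
rewrite peaks_lift // big_map big_seq (eq_bigr _ rel_lift) big_split /=.
rewrite -big_seq -addn1; congr (_ + _); rewrite -big_seq.
have zp : z \in peaks p by rewrite eq_pk mem_cat mem_head orbT.
rewrite (bigD1_seq z zp (sorted_uniq ltn_trans ltnn (sorted_peaks p))) /=.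
by rewrite eqxx big1 // => x /negPf ->.
Qed.

(** For a non-empty [p], the lists force w = H + 1, with H the greatest relative height. The entry
    moved from the list of H to that of w is then the peak z. *)
Lemma path_clusters_lift p w U' L' : closed_path p -> East \notin p ->
  coupled w [::] U' (path_clusters p) L' -> path_clusters (lift_path p) = flip L'.
Proof.
move=> closed_p Ep [w_gt0 _ _ [k Lw wk] [L0 ->]]; apply: functional_extensionality => r.
have [p0|p_n0] := eqVneq p [::].
  have w1 : w = 1.
    move: Lw wk; rewrite p0 /path_clusters /=; case: k => [|k] //= _.
    by clear -w_gt0; lia.
  have rel1 : relative_height (lift_path [::]) 1 = 1.
    rewrite relative_height_max //.
    exists 0, 2; split=> // z; rewrite inE => /eqP -> _; split=> //.
  have -> : path_clusters (lift_path p) r = if r == 1 then [:: false] else [::].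
    rewrite p0 /path_clusters; have -> : peaks (lift_path [::]) = [:: 1] by [].
    by rewrite /filter rel1 [1 == r]eq_sym; case: eqP => _ //; rewrite /map rel1.
  rewrite p0 /flip w1; case: (r =P 1) => //= _; case: eqP => //.
have [s1 [z [s2 [eq_pk lt_s1 le_s2 H_gt0 rel_lift]]]] := lift_relative_height closed_p Ep p_n0.
set H := relative_height p z in lt_s1 le_s2 H_gt0.
have filt r' : path_clusters p r' =
    [seq odd (size p + x + r') | x <- s1 & relative_height p x == r'] ++
    (if H == r' then [:: odd (size p + z + r')] else [::]) ++
    [seq odd (size p + x + r') | x <- s2 & relative_height p x == r'].
  have -> : path_clusters p r' = [seq odd (size p + x + r') | x <- peaks p & relative_height p x == r'].
    by apply/eq_in_map => x; rewrite mem_filter => /andP[/eqP ->].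
  by rewrite eq_pk filter_cat map_cat /= -/H; case: eqP.
have filt_lift r' : path_clusters (lift_path p) r' =
    [seq ~~ odd (size p + x + r') | x <- s1 & relative_height p x == r'] ++
    (if H.+1 == r' then [:: ~~ odd (size p + z + r')] else [::]) ++
    [seq ~~ odd (size p + x + r') | x <- s2 & relative_height p x == r'].
  have -> : path_clusters (lift_path p) r' =
      [seq ~~ odd (size p + x + r') | x <- peaks p & relative_height p x + (x == z) == r'].
    rewrite /path_clusters peaks_lift // filter_map -map_comp.
    have -> : [seq x <- peaks p | preim succn (fun x => relative_height (lift_path p) x == r') x]
        = [seq x <- peaks p | relative_height p x + (x == z) == r'].
      by apply: eq_in_filter => x xp /=; rewrite rel_lift.
    apply/eq_in_map => x; rewrite mem_filter => /andP[/eqP <- xp] /=.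
    by rewrite rel_lift // size_rcons !addSn addnS addSn /= !negbK.
  rewrite {1}eq_pk filter_cat map_cat /= eqxx -/H addn1.
  have [zs1 zs2] : z \notin s1 /\ z \notin s2.
    have := sorted_uniq ltn_trans ltnn (sorted_peaks p); rewrite eq_pk cat_uniq /= negb_or.
    by case/and4P=> _ /andP[zs1 _] zs2 _.
  have eq_filt s : z \notin s -> [seq x <- s | relative_height p x + (x == z) == r'] =
      [seq x <- s | relative_height p x == r'].
    move=> zs; apply: eq_in_filter => x xs; suff /negPf -> : x != z by rewrite addn0.
    by apply: contraNneq zs => <-.
  by rewrite !eq_filt //; case: eqP.
have s1_nil r' : H <= r' -> [seq x <- s1 | relative_height p x == r'] = [::].
  move=> le_r; rewrite (eq_in_filter (a2 := pred0)) ?filter_pred0 // => x /(allP lt_s1) /=; lia.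
have s2_nil r' : H < r' -> [seq x <- s2 | relative_height p x == r'] = [::].
  move=> le_r; rewrite (eq_in_filter (a2 := pred0)) ?filter_pred0 // => x /(allP le_s2) /=; lia.
(* The lists are empty from w on but not at H, so H < w; then w > 1, so the list of w - 1 is not
   empty and w - 1 cannot exceed H. *)
have eq_w : w = H.+1.
  have lt_Hw : H < w.
    by rewrite ltnNge; apply/negP => /L0; rewrite filt eqxx; case: map.
  have w_gt1 : 1 < w by lia.
  rewrite wk in w_gt1; case: k w_gt1 Lw {wk} => // k _.
  rewrite filt; case: (ltngtP H w.-1) => [lt_H|lt_H|->] //; try lia.
  by rewrite s1_nil ?s2_nil //; lia.
rewrite {}eq_w /= in L0 Lw *.
rewrite filt_lift; rewrite /flip; case: (r =P H.+1) => [->|neq_r].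
  rewrite eqxx s1_nil ?s2_nil //=.
  move: Lw; rewrite filt eqxx s1_nil //=; case: k {wk} => //= k [+ _].
  by rewrite !addnS /= => ->.
rewrite [H.+1 == r]eq_sym (introF eqP neq_r) /=.
case: (r =P H) => [->|neq_rH]; rewrite filt.
  by rewrite eqxx s1_nil //= -map_comp.
by rewrite [H == r]eq_sym (introF eqP neq_rH) /= map_cat -!map_comp.
Qed.

Lemma scan_coupled p w U U' L L' : East \notin p -> legal_from (size U) p ->
  scan_inv U L -> coupled w U U' L L' ->
  exists w', coupled w' (foldl scan_step (U, L) p).1 (foldl scan_step (U', L') p).1
    (foldl scan_step (U, L) p).2 (foldl scan_step (U', L') p).2.
Proof.
elim: p w U U' L L' => [|s p IH] w U U' L L' /=; first by exists w.
rewrite inE negb_or => /andP[Es Ep] /andP[legal_s legal_p] inv cpl.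
have [sU U_0 _] := inv; have := scan_inv_step s inv.
case: s Es legal_s legal_p => //= _ legal_s legal_p inv'.
  have [w' cpl'] := coupled_NorthEast inv cpl.
  by apply: IH cpl'; rewrite ?size_insert_least.
apply: IH (coupled_behead _ cpl); rewrite ?size_behead //.
by case: (U) legal_s.
Qed.

(** After its first step the lifted path reads [p] from level 1, in parallel with the reading from
    level 0; the coupling starts with w = 1. *)
Lemma scan_lift p : closed_path p -> East \notin p ->
  foldl scan_step ([::], no_clusters) p = ([::], path_clusters p) ->
  exists U' L' w, coupled w [::] U' (path_clusters p) L' /\
    foldl scan_step ([::], no_clusters) (lift_path p) = ([::], flip L').
Proof.
move=> /andP[legal_p _] Ep scanp.
set U1 := insert_mark 1 [::]; set L1 := flip (add_mark false no_clusters 1).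
have cpl1 : coupled 1 [::] U1 no_clusters L1.
  split=> //; first by exists 0.
  split=> //; apply: functional_extensionality => r.
  by rewrite /L1 /flip /add_mark /push /=; case: (r == 1) => //; case: (r == 0).
have [//|w cpl] := @scan_coupled p 1 [::] U1 no_clusters L1 Ep legal_p _ cpl1.
rewrite scanp /= in cpl; set st := foldl scan_step (U1, L1) p in cpl.
have scan_lift : foldl scan_step ([::], no_clusters) (lift_path p) = scan_step st SouthEast.
  rewrite /lift_path -cats1 /= foldl_cat /= (@least_unused_eq 1) //.
  by move=> y; lia.
by exists st.1, st.2, w; rewrite scan_lift; split=> //; case: cpl => _ /= ->.
Qed.

(** Induction on the excursions: concatenation acts alike on the scan and on the lists of peaks, and
    lifting adds one South-East step and 1 to the sum of the relative heights. *)
Lemma scan_closed_path p : closed_path p ->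
  foldl scan_step ([::], no_clusters) p = ([::], path_clusters p) /\
  \sum_(x <- peaks p) relative_height p x = count_mem SouthEast p.
Proof.
have inv0 : scan_inv [::] no_clusters by [].
have [n] := ubnP (size p); elim: n => // n IH in p *.
case: p => [|[] p] lt_n closed_p.
- by rewrite big_nil; split=> //; congr pair; apply: functional_extensionality.
- have [legal_p /eqP p0] := andP closed_p.
  have [A [B [eq_p closed_A EA legal_B B0]]] := first_return legal_p p0.
  have eq_lift : NorthEast :: p = lift_path A ++ B by rewrite eq_p /lift_path /= cat_rcons.
  have closed_B : closed_path B by rewrite /closed_path legal_B B0.
  have ltAB : (size A < n) && (size B < n).
    by move: lt_n; rewrite /= eq_p size_cat /=; lia.
  have [ltA ltB] := andP ltAB.
  have [scanA sumA] := IH A ltA closed_A; have [scanB sumB] := IH B ltB closed_B.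
  have closed_lift := lift_closed closed_A EA.
  rewrite eq_lift sum_relative_height_cat // count_cat sum_relative_height_lift // sumA sumB.
  split; last by rewrite /= -cats1 count_cat /=; lia.
  rewrite foldl_cat path_clusters_cat //.
  have -> : foldl scan_step ([::], no_clusters) (lift_path A) = ([::], path_clusters (lift_path A)).
    have [U' [L' [w [cpl ->]]]] := scan_lift closed_A EA scanA.
    by rewrite (path_clusters_lift closed_A EA cpl).
  have := @scan_cat (path_clusters (lift_path A)) [::] no_clusters B inv0.
  have -> : cat_clusters (path_clusters (lift_path A)) no_clusters = path_clusters (lift_path A).
    by apply: functional_extensionality => r; rewrite /cat_clusters cats0.
  by rewrite scanB => ->.
- by [].
have closed_E : closed_path [:: East] by [].
have [closed_p' ltp] : closed_path p /\ size p < n by [].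
have [scanp sump] := IH p ltp closed_p'.
rewrite -cat1s sum_relative_height_cat // big_nil sump; split=> //.
rewrite [LHS]scanp path_clusters_cat //; congr pair.
by apply: functional_extensionality => r; rewrite /cat_clusters iter_flip.
Qed.

(** * Clusters of a partition *)

Definition near (a b : nat) : bool := (b == a) || (b.+1 == a).

Notation mk la i := (nth 0 (gordon_marking la) i).

Lemma size_gordon_marking la : size (gordon_marking la) = size la.
Proof. by elim: la => //= p la ->. Qed.

Lemma mem_near_marks p la y :
  reflect (exists2 j, j < size la & mk la j = y /\ near p (nth 0 la j))
    (y \in [seq q.2 | q <- zip la (gordon_marking la) & near p q.1]).
Proof.
have sz := size_gordon_marking la.
have szip : size (zip la (gordon_marking la)) = size la by rewrite size_zip sz minnn.
apply: (iffP mapP) => [[q]|[j lt_j [<- near_j]]].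
  rewrite mem_filter => /andP[near_q /(nthP (0, 0))[j lt_j eq_q]] ->.
  rewrite szip in lt_j; exists j => //; move: near_q; rewrite -eq_q nth_zip //=.
exists (nth 0 la j, mk la j) => //; rewrite mem_filter near_j -nth_zip //.
by rewrite mem_nth ?szip.
Qed.

Lemma gordon_marking_gt0 la i : i < size la -> 0 < mk la i.
Proof.
by elim: la i => //= p la IH [|i] //=; apply: IH.
Qed.

Lemma gordon_marking_neq la i j : i < j -> j < size la ->
  near (nth 0 la i) (nth 0 la j) -> mk la i != mk la j.
Proof.
elim: la i j => //= p la IH [|i] [|j] //= lt_ij lt_j near_ij; last exact: IH.
have [_ + _] := least_unusedP [seq q.2 | q <- zip la (gordon_marking la) & near p q.1].
by apply: contraNneq => ->; apply/mem_near_marks; exists j.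
Qed.

Lemma gordon_marking_ex la i y : i < size la -> 0 < y < mk la i ->
  exists j, [/\ i < j, j < size la, mk la j = y & near (nth 0 la i) (nth 0 la j)].
Proof.
elim: la i => //= p la IH [|i] /= lt_i lt_y.
  have [_ _ ltl] := least_unusedP [seq q.2 | q <- zip la (gordon_marking la) & near p q.1].
  by have /mem_near_marks[j lt_j [eq_y near_j]] := ltl _ lt_y; exists j.+1.
by have [//|j [lt_ij lt_j eq_y near_j]] := IH i _ lt_y; exists j.+1.
Qed.

Definition is_top_index (la : seq nat) (i : nat) : bool :=
  ~~ has (fun j => (mk la j == (mk la i).+1) && near (nth 0 la j) (nth 0 la i)) (iota 0 (size la)).

(** Parts are added in the order of the marking, the smallest first; [~~ odd] is the parity of the
    part minus 1. *)
Definition list_clusters (la : seq nat) : nat -> seq bool :=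
  foldr (fun q L => add_mark (~~ odd q.1) L q.2) no_clusters (zip la (gordon_marking la)).

Lemma sorted_geq_nth la i j : sorted geq la -> i <= j -> nth 0 la j <= nth 0 la i.
Proof.
move=> s_la le_ij; have [lt_j|le_j] := ltnP j (size la); last by rewrite nth_default.
have geq_trans : transitive geq by move=> a b c /= ? ?; lia.
by apply: (sorted_leq_nth geq_trans _ 0 s_la) => //= [x|]; rewrite ?inE /=; lia.
Qed.

Lemma is_top_index_cons p la i : sorted geq (p :: la) ->
  is_top_index (p :: la) i.+1 =
  is_top_index la i && ~~ ((mk (p :: la) 0 == (mk la i).+1) && near p (nth 0 la i)).
Proof.
move=> _; rewrite /is_top_index /= negb_or andbC; congr (~~ _ && _).
by rewrite (iotaDl 1 0) has_map; apply: eq_has => j.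
Qed.

Lemma is_top_index0 p la : sorted geq (p :: la) -> is_top_index (p :: la) 0.
Proof.
move=> s_pla; apply/hasPn => j; rewrite mem_iota add0n => lt_j; apply/negP => /andP[/eqP mkj near_j].
have m_gt0 := @gordon_marking_gt0 (p :: la) 0 isT.
have [|l [lt_jl lt_l mkl near_l]] := @gordon_marking_ex (p :: la) j (mk (p :: la) 0) lt_j.
  by rewrite mkj m_gt0 /=.
have l_gt0 : 0 < l by lia.
suff /(gordon_marking_neq l_gt0 lt_l) : near (nth 0 (p :: la) 0) (nth 0 (p :: la) l) by rewrite mkl eqxx.
by have := sorted_geq_nth s_pla (leq0n j); move: near_j near_l; rewrite /near; lia.
Qed.

(* [pi i] stands for the parity of the cluster of i truncated at i. *)
Lemma list_clustersE la (pi : nat -> bool) : sorted geq la ->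
  (forall i, i < size la -> mk la i = 1 -> pi i = ~~ odd (nth 0 la i)) ->
  (forall i j, i < size la -> j < size la -> mk la i = (mk la j).+1 ->
     near (nth 0 la i) (nth 0 la j) -> pi i = ~~ odd (nth 0 la i) (+) pi j) ->
  forall r, list_clusters la r =
    [seq pi i | i <- rev (iota 0 (size la)) & (mk la i == r) && is_top_index la i].
Proof.
elim: la pi => // p la IH pi s_pla pi1 piS r.
have s_la : sorted geq la := path_sorted s_pla.
set m := mk (p :: la) 0.
have m_gt0 : 0 < m := @gordon_marking_gt0 (p :: la) 0 isT.
have {}IH r' : list_clusters la r' =
    [seq pi i.+1 | i <- rev (iota 0 (size la)) & (mk la i == r') && is_top_index la i].
  apply: (IH (fun i => pi i.+1)) => // [i lt_i|i j lt_i lt_j]; first exact: (pi1 i.+1).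
  exact: (piS i.+1 j.+1).
have -> : list_clusters (p :: la) = add_mark (~~ odd p) (list_clusters la) m by [].
have -> : [seq pi i | i <- rev (iota 0 (size (p :: la))) & (mk (p :: la) i == r) && is_top_index (p :: la) i]
   = [seq pi i.+1 | i <- rev (iota 0 (size la))
        & (mk la i == r) && (is_top_index la i && ~~ ((m == (mk la i).+1) && near p (nth 0 la i)))]
     ++ (if m == r then [:: pi 0] else [::]).
  rewrite /= (iotaDl 1 0) rev_cons filter_rcons is_top_index0 // andbT -map_rev filter_map.
  rewrite -/m.
  have -> : [seq x <- rev (iota 0 (size la)) | preim (addn 1) (fun i => (mk (p :: la) i == r) && is_top_index (p :: la) i) x]
      = [seq i <- rev (iota 0 (size la)) | (mk la i == r) && (is_top_index la i && ~~ ((m == (mk la i).+1) && near p (nth 0 la i)))].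
    by apply: eq_filter => i /=; rewrite is_top_index_cons.
  by case: ifP => _; rewrite ?cats0 ?map_rcons -?cats1 -map_comp.
have mk_gt0 i : i \in rev (iota 0 (size la)) -> 0 < mk la i.
  by rewrite mem_rev mem_iota; apply: gordon_marking_gt0.
have [m1|m_gt1] : m = 1 \/ 1 < m by lia.
  rewrite m1 /add_mark /= /push IH [1 == r]eq_sym.
  have -> : [seq i <- rev (iota 0 (size la)) | (mk la i == r) && (is_top_index la i && ~~ ((1 == (mk la i).+1) && near p (nth 0 la i)))]
    = [seq i <- rev (iota 0 (size la)) | (mk la i == r) && is_top_index la i].
    by apply: eq_in_filter => i /mk_gt0; case: (mk la i) => //= k _; rewrite andbT.
  case: eqP => _; last by rewrite cats0.
  by rewrite cats1 pi1.
have [|j [j_gt0 lt_j mkj near_j]] := @gordon_marking_ex (p :: la) 0 m.-1 isT.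
  by rewrite -/m; lia.
case: j j_gt0 lt_j mkj near_j => // j _; rewrite /= ltnS => lt_j mkj near_j.
have pi0 : pi 0 = ~~ odd p (+) pi j.+1.
  by apply: (piS 0 j.+1) => //; rewrite -/m /= mkj prednK.
have p_ge i : nth 0 la i <= p := sorted_geq_nth s_pla (leq0n i.+1).
(* Parts listed before j lie between that of j and p, so they are near it and cannot repeat its
   mark. Thus j is the last (m-1)-marked part read, and [add_mark] extends the right cluster. *)
have lt_neq i : i < j -> mk la i != m.-1.
  move=> lt_ij; rewrite -mkj; apply: gordon_marking_neq => //.
  have := p_ge i; have := sorted_geq_nth s_la (ltnW lt_ij); move: near_j; rewrite /near; lia.
have gt_neq i : j < i < size la -> near p (nth 0 la i) -> mk la i != m.-1.
  case/andP=> lt_ji lt_i near_i; rewrite -mkj eq_sym; apply: gordon_marking_neq => //.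
  have := p_ge j; have := sorted_geq_nth s_la (ltnW lt_ji); move: near_i near_j; rewrite /near; lia.
have top_j : is_top_index la j.
  apply/hasPn => l; rewrite mem_iota add0n => lt_l; apply/negP => /andP[/eqP mkl near_l].
  have eq_mkl : mk la l = m by rewrite mkl mkj prednK.
  have : near (nth 0 (p :: la) 0) (nth 0 (p :: la) l.+1).
    by have := p_ge l; have := p_ge j; move: near_j near_l; rewrite /near /=; lia.
  by move/(@gordon_marking_neq (p :: la) 0 l.+1 isT lt_l); rewrite /= eq_mkl eqxx.
have split_iota : rev (iota 0 (size la)) = rcons (rev (iota j.+1 (size la - j.+1))) j ++ rev (iota 0 j).
  rewrite -{1}(subnKC lt_j) addSnnS iotaD rev_cat add0n; congr (_ ++ _).
  by rewrite -rev_cons.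
have filt0 (a : pred nat) : {in iota 0 j, forall i, a i -> mk la i = m.-1} ->
    [seq i <- rev (iota 0 j) | a i] = [::].
  move=> aP; rewrite filter_rev (eq_in_filter (a2 := pred0)) ?filter_pred0 // => i i_lt.
  apply/negP => /(aP i i_lt) mki; move: i_lt; rewrite mem_iota => /lt_neq.
  by rewrite mki eqxx.
pose s1 := rev (iota j.+1 (size la - j.+1)).
have Lm1 : list_clusters la m.-1 =
    rcons [seq pi i.+1 | i <- s1 & (mk la i == m.-1) && is_top_index la i] (pi j.+1).
  rewrite IH split_iota filter_cat filter_rcons mkj eqxx top_j filt0 /=.
    by rewrite cats0 map_rcons.
  by move=> i _ /andP[/eqP].
rewrite add_markE //; last by right; rewrite Lm1 /nilp size_rcons.
rewrite (gtn_eqF m_gt1) /= andbT Lm1 last_rcons -pi0 [m == r]eq_sym.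
case: (r =P m) => [->|neq_rm].
  rewrite IH -cats1; congr (_ ++ _); congr map; apply: eq_in_filter => i _.
  by case: (mk la i =P m) => //= ->; rewrite ltn_eqF ?andbT.
rewrite cats0; case: (r =P m.-1) => [->|neq_rm1].
  rewrite Lm1 take_rcons_pred split_iota filter_cat filter_rcons filt0 ?cats0; last first.
    by move=> i _ /andP[/eqP].
  rewrite mkj top_j prednK // eqxx near_j /= eqxx /=; congr map.
  apply: eq_in_filter => i; rewrite mem_rev mem_iota => lt_i.
  case: (mk la i =P m.-1) => //= mki; rewrite mki prednK // eqxx /=.
  have -> : near p (nth 0 la i) = false.
    by apply/negP => /(@gt_neq i); rewrite mki eqxx => /(_ _); case/(_ _)/negP; lia.
  by rewrite andbT.
rewrite IH; congr map; apply: eq_in_filter => i _.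
by case: (mk la i =P r) => //= ->; rewrite [m == _]eq_sym (introF eqP) ?andbT //; lia.
Qed.

(** * Clusters as maximal chains of parts *)

Section Clusters.
Variable la : seq nat.
Hypothesis s_la : sorted geq la.

Local Notation I := 'I_(size la).
Implicit Types (i j : I) (C : {set I}) (D : {set {set I}}).

Definition is_parent (j i : I) : bool :=
  (mark la i == (mark la j).+1) && near (part la i) (part la j).

Lemma mark_gt0 i : 0 < mark la i.
Proof. exact: gordon_marking_gt0. Qed.

Lemma mark_inj i j : mark la i = mark la j ->
  near (part la i) (part la j) || near (part la j) (part la i) -> i = j.
Proof.
wlog lt_ij : i j / i < j => [wlog_ij eq_mk near_ij|eq_mk near_ij].
  case: (ltngtP i j) => [|lt_ji|]; [by move/wlog_ij; apply| |by move/val_inj].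
  by apply/esym/wlog_ij; rewrite // orbC.
have := gordon_marking_neq lt_ij (ltn_ord j); rewrite -/(mark la i) -/(mark la j) eq_mk eqxx.
case/(_ _)/negP=> //; have := sorted_geq_nth s_la (ltnW lt_ij).
by rewrite -!/(part la _); move: near_ij; rewrite /near; lia.
Qed.

Lemma parent_ex i : 1 < mark la i -> exists j, is_parent j i.
Proof.
move=> mk_gt1; have [|j [_ lt_j mkj near_j]] := @gordon_marking_ex la i (mark la i).-1 (ltn_ord i).
  by rewrite -/(mark la i); lia.
exists (Ordinal lt_j); rewrite /is_parent near_j andbT.
by have -> : mark la (Ordinal lt_j) = (mark la i).-1 by []; rewrite prednK // ltnW.
Qed.

Lemma parent_inj i j j' : is_parent j i -> is_parent j' i -> j = j'.
Proof.
case/andP=> /eqP mki near_j /andP[/eqP mki' near_j']; apply: mark_inj; first by lia.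
by move: near_j near_j'; rewrite /near; lia.
Qed.

Lemma child_inj i i' j : is_parent j i -> is_parent j i' -> i = i'.
Proof.
case/andP=> /eqP mki near_i /andP[/eqP mki' near_i']; apply: mark_inj; first by lia.
by move: near_i near_i'; rewrite /near; lia.
Qed.

(** Turns the tuple of the definition into local rules, those of a maximal chain for [is_parent]. *)
Lemma is_clusterP r C : is_cluster la r C ->
  [/\ {in C, forall i, mark la i <= r}, {in C &, injective (mark la)},
      {in C, forall i j, is_parent j i -> j \in C},
      {in C, forall i, mark la i < r -> exists2 j, j \in C & is_parent i j}
    & {in C, forall i, mark la i = r -> forall j, ~~ is_parent i j}].
Proof.
case/andP=> r_gt0 /existsP[c /and4P[/eqP -> /eqP eq_mk s_c top_c]].
have mk_nth i0 s : s < r -> mark la (nth i0 c s) = s.+1.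
  by move=> lt_s; rewrite -(nth_map i0 0 (mark la)) ?size_tuple // eq_mk nth_iota.
have near_nth i0 s : s.+1 < r -> is_parent (nth i0 c s) (nth i0 c s.+1).
  move=> lt_s; rewrite /is_parent !mk_nth ?eqxx //=; last by lia.
  have := sortedP 0 s_c s; rewrite size_map size_tuple => /(_ lt_s).
  by rewrite !(nth_map i0) ?size_tuple // /near; lia.
have index_lt i : i \in c -> index i c < r by rewrite -{3}(size_tuple c) index_mem.
have mk_index i : i \in c -> mark la i = (index i c).+1.
  by move=> ic; rewrite -{1}(nth_index i ic) mk_nth ?index_lt.
have mem_c i : (i \in [set:: c]) = (i \in c) by rewrite inE.
have mem_nth_c i0 s : s < r -> nth i0 c s \in [set:: c].
  by move=> lt_s; rewrite mem_c mem_nth ?size_tuple.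
split=> i; rewrite mem_c => ic.
- by rewrite mk_index ?index_lt.
- by move=> j; rewrite mem_c => jc; rewrite !mk_index // => -[/(congr1 (nth i c))]; rewrite !nth_index.
- move=> j par_ji; have /andP[/eqP mki _] := par_ji; rewrite mk_index // in mki.
  have lt_i := index_lt i ic.
  have i_gt0 : 0 < index i c by case: (mki) => ->; apply: mark_gt0.
  have eq_i := prednK i_gt0.
  have := near_nth i (index i c).-1; rewrite eq_i nth_index // => /(_ lt_i) par_i.
  by rewrite (parent_inj par_ji par_i); apply/mem_nth_c/(leq_ltn_trans (leq_pred _)).
- rewrite mk_index // => lt_i; exists (nth i c (index i c).+1); first exact: mem_nth_c.
  by have := near_nth i _ lt_i; rewrite nth_index.
move=> mki j; apply/negP => /andP[/eqP mkj near_j]; have /forallP/(_ j) := top_c.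
rewrite mkj mki eqxx implyTb !inE negb_or.
have -> : last 0 [seq part la i | i <- c] = part la i.
  rewrite -nth_last size_map size_tuple (nth_map i) ?size_tuple; last by lia.
  have eq_r : r.-1 = index i c.
    exact: (congr1 predn (etrans (esym mki) (mk_index i ic))).
  by rewrite eq_r nth_index.
by move: near_j; rewrite /near; lia.
Qed.

Section Decomposition.
Variable D : {set {set I}}.
Hypothesis clD : is_cluster_decomposition la D.

Lemma pblock_cluster i : let C := pblock D i in i \in C /\ is_cluster la #|C| C.
Proof.
case/andP: clD => /and3P[/eqP covD _ _] /forallP allD; have iD : i \in cover D by rewrite covD inE.
rewrite /= mem_pblock iD; split=> //.
by have /implyP := allD (pblock D i); apply; apply: pblock_mem.
Qed.

Lemma is_top_pblock i : (#|pblock D i| == mark la i) = is_top_index la i.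
Proof.
have [iC /is_clusterP[mk_le mk_inj _ child top]] := pblock_cluster i.
apply/idP/hasPn => [/eqP eq_mk j|top_i].
  rewrite mem_iota add0n => lt_j; apply: contra (top i iC (esym eq_mk) (Ordinal lt_j)).
  by case/andP=> mkj near_j; rewrite /is_parent mkj.
rewrite eqn_leq mk_le // andbT leqNgt; apply/negP => /(child i iC)[j jC /andP[mkj near_j]].
by have := top_i j; rewrite mem_iota ltn_ord => /(_ isT)/negP[]; rewrite -/(mark la j) mkj.
Qed.

(** The function [pi] to which [list_clustersE] is applied. *)
Definition block_parity i : bool :=
  odd #|[set j in pblock D i | (mark la j <= mark la i) && ~~ odd (part la j)]|.

Lemma block_parity1 i : mark la i = 1 -> block_parity i = ~~ odd (part la i).
Proof.
move=> mki; have [iC /is_clusterP[_ mk_inj _ _ _]] := pblock_cluster i.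
rewrite /block_parity (cardsD1 i) oddD inE iC leqnn /= oddb eq_card0 ?addbF // => j.
rewrite !inE mki; case: (j =P i) => //= neq_ji; apply/negP => /and3P[jC le_j _].
by case: neq_ji; apply: mk_inj => //; rewrite mki; have := mark_gt0 j; lia.
Qed.

Lemma block_parityS i j : is_parent j i ->
  block_parity i = ~~ odd (part la i) (+) block_parity j.
Proof.
move=> par_ji; have /andP[/eqP mki _] := par_ji.
have [iC /is_clusterP[_ mk_inj parC _ _]] := pblock_cluster i.
have jC := parC i iC j par_ji.
case/andP: clD => /and3P[_ tiD _] _.
have eq_block : pblock D j = pblock D i by apply: same_pblock.
rewrite /block_parity eq_block (cardsD1 i) oddD inE iC leqnn /= oddb; congr (_ (+) odd _).
apply: eq_card => l; rewrite !inE mki; case: (l =P i) => [->|neq_li] /=.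
  by rewrite mki ltnn /= andbF.
case lC: (l \in _) => //=; rewrite leq_eqVlt ltnS -mki; case: eqP => //= eq_l.
by case: neq_li; apply: mk_inj.
Qed.

Lemma cluster_parity_top i : is_top_index la i ->
  cluster_parity la (pblock D i) = ~~ block_parity i.
Proof.
rewrite -is_top_pblock => /eqP eq_mk; have [iC /is_clusterP[mk_le _ _ _ _]] := pblock_cluster i.
rewrite /cluster_parity /block_parity; congr (~~ odd _); apply: eq_card => j.
rewrite !inE; case jC: (j \in _) => //=; by rewrite -eq_mk mk_le.
Qed.

End Decomposition.

Lemma cluster_parities_of_decomposition r :
  is_cluster_decomposition la (cluster_decomposition la) ->
  cluster_parities la r = map negb (list_clusters la r).
Proof.
set D := cluster_decomposition la => clD.
pose pi k := if insub k is Some i then block_parity D i else false.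
have piE (i : I) : pi i = block_parity D i by rewrite /pi valK.
rewrite (@list_clustersE la pi s_la) => [|k lt_k mkk|k l lt_k lt_l mk_kl near_kl]; last first.
- rewrite (piE (Ordinal lt_k)) (piE (Ordinal lt_l)); apply: block_parityS => //.
  by rewrite /is_parent /mark /= mk_kl eqxx.
- by rewrite (piE (Ordinal lt_k)) block_parity1.
rewrite /cluster_parities -/D -val_enum_ord -map_rev filter_map -!map_comp.
rewrite (eq_filter (a2 := preim val (fun k => (mk la k == r) && is_top_index la k))); last first.
  move=> i /=; rewrite -/(mark la i); case: eqP => //= mki.
  by rewrite -(is_top_pblock clD) mki.
apply/eq_in_map => i; rewrite mem_filter => /andP[/= /andP[_ top_i] _].
by rewrite piE cluster_parity_top.
Qed.

End Clusters.

(** * Existence of the cluster decomposition *)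

Section Existence.
Variable la : seq nat.
Hypothesis s_la : sorted geq la.

Local Notation I := 'I_(size la).
Implicit Types (i j : I).

Definition parent i : I := odflt i [pick j | is_parent j i].

Lemma parentP i : 1 < mark la i -> is_parent (parent i) i.
Proof.
rewrite /parent; case: pickP => [j par_ji _ //|no_parent mk_gt1].
by have [j] := parent_ex s_la mk_gt1; rewrite no_parent.
Qed.

Lemma mark_parent i : 1 < mark la i -> (mark la (parent i)).+1 = mark la i.
Proof. by move/parentP => /andP[/eqP ->]. Qed.

(** The 1-marked part reached from i by going down; the clusters are the fibres of this map. *)
Definition root i : I := iter (mark la i).-1 parent i.

Lemma root_parent i : 1 < mark la i -> root (parent i) = root i.
Proof.
move=> mk_gt1; rewrite /root -(mark_parent mk_gt1) /= -iterSr.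
by have := mark_gt0 (parent i); case: (mark la (parent i)).
Qed.

(** A part has at most one child, so a chain that starts at a given root contains at most one part
    of each mark. *)
Lemma root_inj i j : mark la i = mark la j -> root i = root j -> i = j.
Proof.
have [m] := ubnP (mark la i); elim: m => // m IH in i j *.
move=> lt_m eq_mk eq_root; have [mk1|mk_gt1] := leqP (mark la i) 1.
  have mki : mark la i = 1 by have := mark_gt0 i; lia.
  by move: eq_root; rewrite /root -eq_mk mki.
have mkj_gt1 : 1 < mark la j by rewrite -eq_mk.
apply: (child_inj s_la (parentP mk_gt1)); have -> : parent i = parent j.
  have := mark_parent mk_gt1; have := mark_parent mkj_gt1 => mki mkj.
  by apply: IH; rewrite ?root_parent //; lia.
exact: parentP.
Qed.

Lemma ancestor i s (a := iter s parent i) : s < mark la i ->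
  mark la a = mark la i - s /\ root a = root i.
Proof.
rewrite {}/a; elim: s => [|s IH] lt_s /=; first by rewrite subn0.
have [mk_a root_a] := IH (ltnW lt_s).
have a_gt1 : 1 < mark la (iter s parent i) by lia.
rewrite root_parent //; split=> //; have := mark_parent a_gt1; lia.
Qed.

(** The class is the chain of ancestors of its part t of greatest mark r. An (r+1)-marked part that
    prolongs the chain would be a child of t, hence have the same root. *)
Lemma root_block_cluster i0 (C := [set j | root i0 == root j]) : is_cluster la #|C| C.
Proof.
have i0C : i0 \in C by rewrite inE.
pose t := [arg max_(t > i0 in C) mark la t]; pose r := mark la t.
have [tC t_max] : t \in C /\ {in C, forall j, mark la j <= r}.
  by rewrite /r /t; case: arg_maxnP.
have root_t : root t = root i0 by move: tC; rewrite inE => /eqP.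
have r_gt0 : 0 < r := mark_gt0 t.
pose c := [seq iter (r - s) parent t | s <- iota 1 r].
have mk_c : [seq mark la i | i <- c] = iota 1 r.
  rewrite -map_comp -[RHS]map_id; apply/eq_in_map => s; rewrite mem_iota => lt_s /=.
  by have [|-> _] := @ancestor t (r - s); rewrite -/r; lia.
have mem_c j : (j \in c) = (j \in C).
  rewrite !inE; apply/mapP/eqP => [[s]|root_j].
    rewrite mem_iota => lt_s ->; have [|_ ->] := @ancestor t (r - s); rewrite -/r //; lia.
  have jC : j \in C by rewrite inE root_j.
  have := t_max j jC; have := mark_gt0 j => mkj_gt0 mkj_le.
  exists (mark la j); first by rewrite mem_iota; lia.
  have [|mk_a root_a] := @ancestor t (r - mark la j); first by rewrite -/r; lia.
  by apply: root_inj; rewrite ?mk_a ?root_a ?root_t // -/r; lia.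
have sz_c : size c = r by rewrite size_map size_iota.
have uniq_c : uniq c by apply: (map_uniq (f := mark la)); rewrite mk_c iota_uniq.
have -> : #|C| = r by rewrite -sz_c -(card_uniqP uniq_c); apply: eq_card => j; rewrite mem_c.
rewrite /is_cluster r_gt0; apply/existsP; have szc : size c == r by apply/eqP.
exists (Tuple szc); rewrite /= mk_c eqxx.
have last_c : last 0 [seq part la i | i <- c] = part la t.
  rewrite -nth_last size_map sz_c (nth_map t) ?sz_c; last by lia.
  rewrite (nth_map 0) ?size_iota; last by lia.
  by rewrite nth_iota; last lia; rewrite add1n prednK // subnn.
apply/and4P; split=> //.
- by apply/eqP/setP => j; rewrite -mem_c !inE.
- apply/(sortedP 0) => s; rewrite size_map sz_c => lt_s.
  rewrite !(nth_map t) ?sz_c //; try lia.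
  rewrite !(nth_map 0) ?size_iota //; try lia.
  rewrite !nth_iota; try lia.
  have eq_s : r - (1 + s) = (r - (1 + s.+1)).+1 by lia.
  rewrite eq_s iterS; set a := iter _ parent t.
  have [|mk_a _] := @ancestor t (r - (1 + s.+1)); first by rewrite -/r; lia.
  have /parentP/andP[_] : 1 < mark la a by rewrite mk_a -/r; lia.
  by rewrite /near; lia.
apply/forallP => j; apply/implyP => /eqP mkj; rewrite last_c !inE negb_or.
have j_gt1 : 1 < mark la j by lia.
suff not_child : ~~ is_parent t j.
  by move: not_child; rewrite /is_parent mkj eqxx /near; lia.
apply/negP => par_tj; have jC : j \in C.
  by rewrite inE -root_t -(root_parent j_gt1) (parent_inj s_la (parentP j_gt1) par_tj).
by have := t_max j jC; rewrite mkj ltnn.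
Qed.

Lemma cluster_decompositionP : is_cluster_decomposition la (cluster_decomposition la).
Proof.
rewrite /cluster_decomposition; case: pickP => //= noD.
have := noD (preim_partition root [set: I]).
rewrite /is_cluster_decomposition preim_partitionP /= => /negbT/negP[].
apply/forallP => C; apply/implyP => /imsetP[i _ ->].
have -> : [set y in [set: I] | root i == root y] = [set j | root i == root j].
  by apply/setP => j; rewrite !inE.
exact: root_block_cluster.
Qed.

Lemma cluster_paritiesE r : cluster_parities la r = map negb (list_clusters la r).
Proof. exact/cluster_parities_of_decomposition/cluster_decompositionP. Qed.

End Existence.

(** * Marks of a partition given by its frequencies *)

Lemma site_marks_ex U n : exists2 V, site_marks U V & size V = n.
Proof.
elim: n => [|n [V [sV V_0 dUV VU] szV]]; first by exists [::].
have [x_gt0 xUV ltx] := least_unusedP (U ++ V); set x := least_unused _ in x_gt0 xUV ltx.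
move: xUV; rewrite mem_cat negb_or => /andP[xU xV].
exists (rcons V x); last by rewrite size_rcons szV.
split.
- rewrite (sorted_pairwise ltn_trans) pairwise_rcons -(sorted_pairwise ltn_trans) sV andbT.
  apply/allP => y yV; rewrite ltnNge; apply/negP => le_xy.
  have neq_xy : x != y by apply: contraNneq xV => ->.
  have := VU y yV x; rewrite mem_cat (negPf xU) (negPf xV); lia.
- by rewrite mem_rcons inE negb_or V_0 andbT; lia.
- by move=> y; rewrite mem_rcons inE => /predU1P[->|/dUV].
move=> y; rewrite mem_rcons inE => y_in z lt_z; rewrite mem_cat mem_rcons inE orbCA.
case/predU1P: y_in => [eq_y|yV]; rewrite -mem_cat; last by rewrite (VU y yV) ?orbT.
by rewrite ltx ?orbT // -eq_y.
Qed.

Lemma marks_from_ex U g : exists2 Us, marks_from U Us & map size Us = g.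
Proof.
elim: g U => [|n g IH] U; first by exists [::].
have [V UV <-] := site_marks_ex U n; have [Us VUs <-] := IH V.
by exists (V :: Us).
Qed.

Fixpoint parts_from (s : nat) (g : seq nat) : seq nat :=
  if g is n :: g' then nseq n s ++ parts_from s.+1 g' else [::].

Lemma size_parts_from s g : size (parts_from s g) = sumn g.
Proof. by elim: g s => //= n g IH s; rewrite size_cat size_nseq IH. Qed.

Lemma sumn_parts_from s g : sumn (parts_from s g) = s * sumn g + weight g.
Proof. by elim: g s => //= [s|n g IH s]; rewrite ?muln0 // sumn_cat sumn_nseq IH; lia. Qed.

Lemma parts_from_ge s g : all (leq s) (parts_from s g).
Proof.
elim: g s => //= n g IH s; rewrite all_cat all_nseq leqnn orbT /=.
by apply: sub_all (IH s.+1) => x /ltnW.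
Qed.

Lemma sorted_parts_from s g : sorted leq (parts_from s g).
Proof.
elim: g s => //= n g IH s; rewrite (sorted_pairwise leq_trans) pairwise_cat.
rewrite -!(sorted_pairwise leq_trans) IH andbT; apply/andP; split.
  apply/allrelP => x y; rewrite mem_nseq => /andP[_ /eqP ->].
  by move/(allP (parts_from_ge _ _)); apply: ltnW.
by elim: n => //= -[|n] //= ->; rewrite leqnn.
Qed.

Lemma count_parts_from s g i :
  count_mem i (parts_from s g) = if s <= i then nth 0 g (i - s) else 0.
Proof.
elim: g s => /= [|n g IH] s; first by rewrite nth_nil if_same.
rewrite count_cat count_nseq IH /=; case: (ltngtP s i) => [lt_si|lt_is|->].
- by rewrite -(subnSK lt_si).
- by [].
by rewrite subnn mul1n addn0.
Qed.

Lemma zip_nseq_marks (a : pred (nat * nat)) s V : (forall y, a (s, y)) ->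
  [seq q.2 | q <- zip (nseq (size V) s) V & a q] = V.
Proof. by move=> a_s; elim: V => //= x V IH; rewrite a_s /= IH. Qed.

Lemma zip_marking_lt s la q : all (ltn^~ s) la -> q \in zip la (gordon_marking la) ->
  q.1 < s.
Proof.
move=> lt_la /(map_f fst) q_in; apply: (allP lt_la).
by rewrite -(unzip1_zip (s := la) (t := gordon_marking la)) ?size_gordon_marking.
Qed.

(** Stated for the prefixes V1 of V so that the parts s are added one at a time; the next mark is
    the least one outside U and V1. *)
Lemma gordon_marking_site s la U V : all (ltn^~ s) la ->
  [seq q.2 | q <- zip la (gordon_marking la) & q.1.+1 == s] =i U ->
  site_marks U V -> forall V1 V2, V = V1 ++ V2 ->
  gordon_marking (nseq (size V1) s ++ la) = rev V1 ++ gordon_marking la.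
Proof.
move=> lt_la la_U [sV V_0 dUV VU]; elim/last_ind => [|V1 x IH] V2 def_V //.
rewrite size_rcons rev_rcons /= (IH (x :: V2)) -?cat_rcons //; congr (_ :: _).
have near_mem y : (y \in [seq q.2 | q <- zip (nseq (size V1) s ++ la) (rev V1 ++ gordon_marking la)
     & (q.1 == s) || (q.1.+1 == s)]) = (y \in V1) || (y \in U).
  rewrite zip_cat ?size_rev ?size_nseq // filter_cat map_cat mem_cat; congr (_ || _).
    by rewrite -(size_rev V1) zip_nseq_marks ?mem_rev // => z; rewrite /= eqxx.
  rewrite -la_U; congr (_ \in map _ _); apply: eq_in_filter => q /(zip_marking_lt lt_la).
  by move/ltn_eqF => /= ->.
have xV : x \in V by rewrite def_V mem_cat mem_rcons mem_head.
have : pairwise ltn V by rewrite -(sorted_pairwise ltn_trans).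
rewrite def_V cat_rcons pairwise_cat /= => /and4P[/allrelP lt_V1 _ /allP lt_V2 _].
apply: least_unused_eq => [||y lt_y].
- by rewrite lt0n; apply: contraNneq V_0 => <-.
- rewrite near_mem negb_or dUV // andbT; apply/negP => xV1.
  by have := lt_V1 x x xV1 (mem_head _ _); rewrite /= ltnn.
rewrite near_mem; have := VU x xV y lt_y; rewrite mem_cat def_V mem_cat mem_rcons inE.
case/or3P=> [->|/predU1P[eq_y|->//]|/lt_V2 /= lt_xy]; rewrite ?orbT //; lia.
Qed.

Lemma gordon_marking_sites s la U Us : all (ltn^~ s) la ->
  [seq q.2 | q <- zip la (gordon_marking la) & q.1.+1 == s] =i U ->
  marks_from U Us ->
  gordon_marking (rev (parts_from s (map size Us)) ++ la) =
  rev (flatten Us) ++ gordon_marking la.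
Proof.
elim: Us s la U => //= V Us IH s la U lt_la la_U [UV VUs].
have gm_V : gordon_marking (nseq (size V) s ++ la) = rev V ++ gordon_marking la.
  by apply: (gordon_marking_site lt_la la_U UV (V2 := [::])); rewrite cats0.
rewrite !rev_cat -!catA rev_nseq -gm_V; apply: IH VUs.
  rewrite all_cat all_nseq ltnSn orbT /=.
  by apply: sub_all lt_la => x; apply: ltnW.
move=> y; rewrite gm_V zip_cat ?size_nseq ?size_rev // filter_cat map_cat mem_cat.
rewrite -{1}(size_rev V) zip_nseq_marks ?mem_rev => [|z]; last by rewrite /= eqxx.
rewrite (eq_in_filter (a2 := pred0)) ?filter_pred0 ?orbF // => q.
by move/(zip_marking_lt lt_la)/ltn_eqF; rewrite eqSS.
Qed.

Lemma sites_clustersE s L Us :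
  foldl (fun L q => add_mark (~~ odd q.1) L q.2) L
    (zip (parts_from s (map size Us)) (flatten Us)) =
  sites_clusters (~~ odd s) L Us.
Proof.
elim: Us s L => //= V Us IH s L; rewrite zip_cat ?size_nseq // foldl_cat IH.
by congr sites_clusters; elim: V L => //= x V IHV L.
Qed.

Lemma list_clusters_sites Us : marks_from [::] Us ->
  list_clusters (rev (parts_from 0 (map size Us))) = sites_clusters true no_clusters Us.
Proof.
move=> marksUs; rewrite /list_clusters.
have := @gordon_marking_sites 0 [::] [::] Us isT _ marksUs; rewrite !cats0 => -> //.
rewrite -rev_zip; last by rewrite size_parts_from size_flatten.
rewrite -(foldl_rev (fun L q => add_mark (~~ odd q.1) L q.2)) revK.
by rewrite sites_clustersE.
Qed.

(** * From frequencies to partitions *)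

Definition partition_of (g : seq nat) : seq nat := rev (parts_from 0 g).

Lemma sorted_partition_of g : sorted geq (partition_of g).
Proof. by rewrite /partition_of rev_sorted sorted_parts_from. Qed.

Lemma count_partition_of g i : count_mem i (partition_of g) = nth 0 g i.
Proof. by rewrite /partition_of count_rev count_parts_from leq0n subn0. Qed.

Lemma partition_ofE la g : sorted geq la -> (forall i, count_mem i la = nth 0 g i) ->
  la = partition_of g.
Proof.
move=> s_la eq_count; apply: (sorted_eq (leT := geq)) => //.
- by move=> x y z /= ? ?; lia.
- by move=> x y /=; lia.
- exact: sorted_partition_of.
by rewrite /perm_eq; apply/allP => i _ /=; rewrite count_partition_of eq_count.
Qed.

(** The two evaluations of the scan from the empty state are equated; the flips by [size p]
    cancel. *)
Lemma peak_parities_burge_path g p r : head 0 g = 0 -> burge_path g p ->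
  peak_parities p r = cluster_parities (partition_of g) r.
Proof.
move=> g0 gP; have /andP[legal_p /eqP p0] := burge_path_legal gP; rewrite g0 in legal_p p0.
have closed_p : closed_path p by rewrite /closed_path legal_p p0.
rewrite cluster_paritiesE ?sorted_partition_of //.
have [Q marksQ szQ] := marks_from_ex [::] (behead g).
pose Us := [::] :: Q; have marksUs : marks_from [::] Us by [].
have eqUs : (forall i, nth 0 (map size Us) i = nth 0 g i).
  move=> i; rewrite /= szQ; case: (g) g0 => [_|x f /= ->] //.
  by case: i => [|i]; rewrite /= ?nth_nil.
have -> : partition_of g = rev (parts_from 0 (map size Us)).
  symmetry; apply: partition_ofE => [|i]; first exact: sorted_partition_of.
  by rewrite count_partition_of.
rewrite list_clusters_sites //.
have := @scan_burge_path [::] [::] Q p marksUs.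
rewrite -(burge_path_eq _ eqUs) in gP; move=> /(_ gP) /=.
rewrite (scan_closed_path closed_p).1 => -[/(congr1 (fun L => L r))].
rewrite iter_flip /path_clusters /peak_parities => eq_r.
have {eq_r} -> : sites_clusters false no_clusters Q r =
    map (addb (odd (size p))) [seq odd (size p + x + relative_height p x) | x <- peaks p & relative_height p x == r].
  by rewrite eq_r -map_comp -[LHS]map_id; apply: eq_map => b /=; rewrite addbA addbb.
rewrite -!map_comp; apply: eq_map => x /=.
by rewrite /peak_parity -addnA [odd (size p + _)]oddD addbA addbb.
Qed.

(** Both sides say that a cell belongs to the Young diagram, read by rows or by columns. *)
Lemma leq_nth_count la x j : sorted geq la -> 0 < x ->
  (x <= nth 0 la j) = (j < count (leq x) la).
Proof.
move=> + x_gt0; elim: la j => [|p la IH] j /= s_la; first by rewrite nth_nil; lia.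
have s_la' := path_sorted s_la; case: (leqP x p) => [le_xp|lt_px].
  by case: j le_xp => [|j] /= le_xp; rewrite ?le_xp ?IH.
have -> : count (leq x) la = 0.
  apply/eqP; rewrite -leqn0 leqNgt -has_count; apply/hasPn => y y_la.
  have geq_trans : transitive geq by move=> a b c /= ? ?; lia.
  by have := allP (order_path_min geq_trans s_la) y y_la; rewrite /=; lia.
case: j => [|j] /=; first by lia.
have := @sorted_geq_nth (p :: la) 0 j.+1 s_la isT; rewrite /=; lia.
Qed.

Lemma count_leq_split la i :
  count (leq i) la = count (leq i.+2) la + count_mem i la + count_mem i.+1 la.
Proof. by elim: la => //= p la ->; lia. Qed.

Lemma pairs_ltP k g : 0 < k ->
  reflect (forall i, nth 0 g i + nth 0 g i.+1 < k) (pairs_lt k g).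
Proof.
move=> k_gt0; elim: g => [|x g IH] /=; first by constructor=> i; rewrite !nth_nil.
rewrite -nth0; apply: (iffP andP) => [[lt_x /IH lt_g] [|i]|lt_g] //=.
by split; [apply: (lt_g 0)|apply/IH => i; apply: (lt_g i.+1)].
Qed.

(** The difference condition fails exactly when k consecutive parts lie in some {a, a + 1}, that is
    when these two sites hold at least k parts. As site 0 is empty, the bound on the parts 1 is the
    inequality at sites 0 and 1. *)
Lemma Bkk_conditionE k g : 0 < k -> head 0 g = 0 ->
  Bkk_condition k (partition_of g) = pairs_lt k g.
Proof.
move=> k_gt0 g0; set la := partition_of g; have s_la : sorted geq la := sorted_partition_of g.
have count0 : count_mem 0 la = 0 by rewrite count_partition_of nth0.
apply/andP/(pairs_ltP g k_gt0) => [[/allP cond count1] i|lt_g].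
  rewrite -!count_partition_of -/la; case: i => [|i]; first by rewrite count0; lia.
  rewrite ltnNge; apply/negP => ge_k.
  (* Position j is that of the first part less than i + 3; the k parts from there on would all be i
     + 1 or i + 2. *)
  have := count_leq_split la i.+1; set j := count (leq i.+3) la => eq_count.
  have le_size := count_size (leq i.+1) la.
  have lt_j : j \in iota 0 ((size la).+1 - k) by rewrite mem_iota; lia.
  have := cond j lt_j; have := leq_nth_count (j + k.-1) s_la (ltn0Sn i).
  have := leq_nth_count j s_la (ltn0Sn i.+2); rewrite -/j; lia.
split; last by have := lt_g 0; rewrite -!count_partition_of -/la count0; lia.
apply/allP => j; rewrite mem_iota => lt_j; rewrite leqNgt; apply/negP => lt_nth.
have la_gt0 : 0 < nth 0 la j.
  rewrite lt0n; apply/negP => /eqP nth0_j.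
  have j_lt : j < size la by lia.
  have := mem_nth 0 j_lt; rewrite nth0_j.
  by rewrite -has_pred1 has_count count0.
move: la_gt0 lt_nth (leq_nth_count j s_la (ltn0Sn (nth 0 la j))).
case def_a: (nth 0 la j) => [//|a] _ lt_nth.
have := lt_g a; rewrite -!count_partition_of -/la.
have := count_leq_split la a.
(* For a = 0, [leq_nth_count] does not apply, and the bound on j + k - 1 by the size is used
   instead. *)
have [a0|a_gt0] := posnP a.
  have -> : count (leq a) la = size la.
    by rewrite a0 -count_predT; apply: eq_count => x; rewrite leq0n.
  lia.
have := leq_nth_count (j + k.-1) s_la a_gt0.
lia.
Qed.

(** * The bijection *)

Definition is_Bkk_partition (k l m n : nat) (la : seq nat) : bool :=
  [&& is_partition_of n la, size la == m, Bkk_condition k la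
    & full_cluster_parity_index la k == l].

Definition is_Ekk_path (k l m n : nat) (p : seq step) : bool :=
  [&& is_lattice_path p, special_kk k p, major_index p == n,
      \sum_(x <- peaks p) relative_height p x == m
    & full_peak_parity_index p k == l].

Lemma is_partition_of_partition_of n g : head 0 g = 0 ->
  is_partition_of n (partition_of g) = (weight g == n).
Proof.
move=> g0; rewrite /is_partition_of sorted_partition_of /= sumn_rev sumn_parts_from.
suff -> : all (leq 1) (partition_of g) by [].
apply/allP => x x_in; rewrite lt0n; apply/eqP => x0.
by move: x_in; rewrite x0 -has_pred1 has_count count_partition_of nth0 g0.
Qed.

Lemma is_Ekk_burge_path k l m n g p : 0 < k -> head 0 g = 0 -> burge_path g p ->
  is_Ekk_path k l m n p = is_Bkk_partition k l m n (partition_of g).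
Proof.
move=> k_gt0 g0 gP; have := burge_path_legal gP; rewrite g0 => closed_p.
have [legal_p /eqP p0] := andP closed_p.
rewrite /is_Ekk_path /is_Bkk_partition is_partition_of_partition_of //.
have -> : is_lattice_path p.
  by rewrite /is_lattice_path legal_p /height take_size p0 eqxx (burge_path_last gP).
rewrite (major_index_burge_path gP) (scan_closed_path closed_p).2 (count_SouthEast gP).
rewrite size_rev size_parts_from Bkk_conditionE // (pairs_lt_burge_path k_gt0 gP) g0.
rewrite special_kkE k_gt0 /=.
have -> : full_peak_parity_index p k = full_cluster_parity_index (partition_of g) k.
  by apply: eq_bigr => r _; rewrite (peak_parities_burge_path r g0 gP).
by do 3![case: (_ == _); rewrite ?andbF ?andbT //=].
Qed.

Definition frequencies (n : nat) (la : seq nat) : seq nat :=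
  [seq count_mem i la | i <- iota 0 n.+1].

Lemma nth_frequencies n la i : all (geq n) la -> nth 0 (frequencies n la) i = count_mem i la.
Proof.
move=> le_la; have [le_in|lt_ni] := leqP i n.
  by rewrite (nth_map 0) ?size_iota // nth_iota.
rewrite nth_default ?size_map ?size_iota //; apply/esym/count_memPn/negP => /(allP le_la) /=; lia.
Qed.

Lemma partition_of_frequencies n la : sorted geq la -> all (geq n) la ->
  partition_of (frequencies n la) = la.
Proof.
by move=> s_la le_la; apply/esym/partition_ofE => // i; rewrite nth_frequencies.
Qed.

Lemma is_partition_of_le n la : is_partition_of n la -> all (geq n) la.
Proof.
case/and3P=> _ _ /eqP <-; elim: la => //= p la IH; rewrite leq_addr /=.
by apply: sub_all IH => x /=; lia.
Qed.

Definition path_of (n : nat) (la : seq nat) : seq step :=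
  xchoose (burge_path_exists (frequencies n la)).

Lemma path_ofP n la : burge_path (frequencies n la) (path_of n la).
Proof. exact: xchooseP. Qed.

Lemma head_frequencies n la : is_partition_of n la -> head 0 (frequencies n la) = 0.
Proof.
case/and3P=> _ la_gt0 _; rewrite /= ; apply/count_memPn/negP => /(allP la_gt0).
by [].
Qed.

Lemma is_Ekk_path_of k l m n la : 0 < k -> is_Bkk_partition k l m n la ->
  is_Ekk_path k l m n (path_of n la).
Proof.
move=> k_gt0 la_B; have /and4P[la_n _ _ _] := la_B; have /and3P[s_la _ _] := la_n.
have le_la := is_partition_of_le la_n.
rewrite (is_Ekk_burge_path _ _ _ k_gt0 (head_frequencies la_n) (path_ofP n la)).
by rewrite partition_of_frequencies.
Qed.

Lemma path_of_inj n : {in is_partition_of n &, injective (path_of n)}.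
Proof.
move=> la mu la_n mu_n eq_path.
have /and3P[s_la _ _] := la_n; have /and3P[s_mu _ _] := mu_n.
rewrite -(partition_of_frequencies s_la (is_partition_of_le la_n)).
rewrite -(partition_of_frequencies s_mu (is_partition_of_le mu_n)).
congr partition_of; apply: burge_path_inj (path_ofP n la) _; first by rewrite !size_map.
by rewrite eq_path; apply: path_ofP.
Qed.

Lemma path_of_surj k l m n p : 0 < k -> is_Ekk_path k l m n p ->
  exists2 la, is_Bkk_partition k l m n la & path_of n la = p.
Proof.
move=> k_gt0 pE; have /and5P[/and3P[legal_p p0 last_p] _ _ _ _] := pE.
rewrite /height take_size in p0.
have [g [_ g0] gP] := burge_path_surj legal_p (eqP p0) last_p.
exists (partition_of g); first by rewrite -(is_Ekk_burge_path _ _ _ k_gt0 g0 gP).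
have la_n : is_partition_of n (partition_of g).
  by move: pE; rewrite (is_Ekk_burge_path _ _ _ k_gt0 g0 gP) => /and4P[].
apply: burge_path_uniq (path_ofP n (partition_of g)) _.
rewrite (burge_path_eq _ (g := g)) // => i.
by rewrite nth_frequencies ?is_partition_of_le // count_partition_of.
Qed.

Theorem theorem2p9 (k l m n : nat) (hk : 1 <= k) :
  Ekk k l m n = Bkk k l m n.
Proof.
rewrite /Ekk /Bkk !cardE.
set E := enum _; set B := enum _.
have mem_E (p : (n.*2).-bseq step) : (p \in E) = is_Ekk_path k l m n p.
  by rewrite mem_enum inE.
have mem_B (t : m.-tuple 'I_n.+1) : (t \in B) = is_Bkk_partition k l m n [seq val i | i <- t].
  by rewrite mem_enum inE /is_Bkk_partition size_map size_tuple eqxx.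
pose part_of (t : m.-tuple 'I_n.+1) := [seq val i | i <- t].
(* The two sets live in different finite types; they are compared as duplicate-free lists of step
   sequences. *)
rewrite -(size_map val) -[RHS](size_map (path_of n \o part_of)).
apply/perm_size/uniq_perm.
- by rewrite map_inj_uniq ?enum_uniq //; apply: val_inj.
- rewrite map_inj_in_uniq ?enum_uniq // => t u; rewrite !mem_B => /and4P[t_n _ _ _] /and4P[u_n _ _ _].
  move/(path_of_inj t_n u_n)/(inj_map val_inj); exact: val_inj.
move=> p; apply/mapP/mapP => [[q]|[t]].
  rewrite mem_E => qE ->; have [la la_B eq_q] := path_of_surj hk qE.
  have /and4P[la_n /eqP sz_la _ _] := la_B.
  have sz : size [seq inord i : 'I_n.+1 | i <- la] == m by rewrite size_map sz_la.
  have eq_la : part_of (Tuple sz) = la.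
    rewrite /part_of /= -map_comp -[RHS]map_id; apply/eq_in_map => i /(allP (is_partition_of_le la_n)) le_in.
    by rewrite /= inordK.
  by exists (Tuple sz); rewrite ?mem_B -/(part_of _) /= eq_la // eq_q.
rewrite mem_B => tB ->; have pE := is_Ekk_path_of hk tB.
have /and5P[p_lattice _ /eqP p_n _ _] := pE.
have sz : size (path_of n (part_of t)) <= n.*2 by rewrite -{2}p_n size_lattice_path.
by exists (Bseq sz); rewrite ?mem_E.
Qed.
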